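(* (a) There is a function $\eta:\mathbb{N}\to[0,\infty)$ with $\eta(n)\to0$ as $n\to\infty$ such that for every $n$, every graph $G$ with $n$ vertices and minimum degree $\delta$ contains a spanning subgraph $H$ with $$m(H)\le (1+\eta(n))\left\lceil \frac{n}{\delta+1}\right\rceil+2.$$ (b) There is $n_0$ such that every graph $G$ with $n\ge n_0$ vertices and minimum degree $\delta$ satisfying $\delta^{1.24}\ge n$ contains a spanning subgraph $H$ with $m(H)\le \left\lceil \frac{n}{\delta+1}\right\rceil+2$.
   Context: All graphs are finite and simple. For a graph $G$ and an integer $k\ge 0$, $m(G,k)$ denotes the number of vertices of degree exactly $k$ in $G$, and $m(G)=\max_k m(G,k)$. A spanning subgraph of $G$ is a subgraph with the same vertex set as $G$. *)

(* Defs.v *)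
From mathcomp Require Import all_boot.
From Stdlib Require Import Reals.
Set Implicit Arguments. Unset Strict Implicit. Unset Printing Implicit Defensive.

Definition simple_graph (T : finType) (e : rel T) : Prop :=
  symmetric e /\ irreflexive e.

Definition deg (T : finType) (e : rel T) (x : T) : nat := #|[set y | e x y]|.

Definition mult (T : finType) (e : rel T) (k : nat) : nat :=
  #|[set x | deg e x == k]|.

(* m(G) = max_k m(G,k); degrees are < #|T|, so ranging k over 0..#|T| suffices *)
Definition mrep (T : finType) (e : rel T) : nat :=
  \max_(k < #|T|.+1) mult e k.

Definition is_mindeg (T : finType) (e : rel T) (d : nat) : Prop :=
  (forall x, d <= deg e x) /\ (exists x, deg e x = d).

Definition spanning_subgraph (T : finType) (h e : rel T) : Prop :=
  simple_graph h /\ (forall x y, h x y -> e x y).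

Definition ceil_div (n d : nat) : nat := (n + d) %/ d.+1.

(* Main.v *)
(** If every vertex v draws a uniform x_v in [0, 1] and uv is kept when
    x_u + x_v >= 1, the degree of v is uniform on {0, ..., d(v)}, so that every
    value is expected at most n / (delta + 1) times.

    For small delta (delta^8 < n) a second moment bound shows that the numbers of
    repetitions are concentrated.  Each vertex owns delta of its edges; an edge owned
    by one end only is compared with a fresh variable instead of the x of the other
    end, so that every variable influences at most delta + 1 degrees.

    For larger delta a random set B of density 1/m is reserved, where m is a large
    constant for (a) and of order n / delta for (b).  A sparse random set F of edges
    between B and its complement A is at the disposal of the vertices of A, which
    use it to reach exact degrees, spread with multiplicity about n / (delta + 1).  The
    edges inside B then serve to move the degrees of B into pairs {2k, 2k+1}, each used
    only few times, by the theorem of Addario-Berry, Dalal, McDiarmid, Reed and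
    Thomason on subgraphs with d_H(v) in {a, a+1, b, b+1}.  The fluctuations of the
    degrees must be smaller than delta / m^2, which in case (b) amounts to
    delta^5 >> n^4 log n. *)

(* When [n / (delta + 1)] is bounded, the number of vertices of one given degree does not
   concentrate; only counts over long intervals of degrees do. The edges of F give every vertex of A
   a window of reachable degrees, and [queue_assignment] turns interval counts into a bound for each
   single degree without worsening the density. The reserve has two prices. B adds repetitions of
   order [n / (delta * m)], whereas A gives up as settled edges only those of F into B, a fraction
   [1 / m ^ 2]. For constant [m] both are small proportions of [n / delta]. In (b) only one
   repetition may be spent on B, which forces [m] up to the order of [n / delta]. The degree windows
   then shrink to [delta / m ^ 2], and the exponent of (b) suffices because [25 / 31 > 4 / 5] leaves
   a small power of [n] for the logarithm. All probabilities are ratios of cardinalities: the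
   labels, and with them the threshold variables, range over finite sets. *)
Require Import Defs.
From mathcomp Require Import all_boot all_order all_fingroup all_algebra.
From mathcomp Require Import boolp Rstruct reals sequences exp.
From mathcomp Require Import ring lra zify.
Set Implicit Arguments. Unset Strict Implicit. Unset Printing Implicit Defensive.
Import Order.TTheory GRing.Theory Num.Theory.

(** * Degree constrained subgraphs *)

(* [lia] without the hypotheses, whose preprocessing is too slow in large contexts. *)
Ltac lia_goal :=
  repeat match goal with H : ?P |- _ => match type of P with Prop => clear H end end; lia.

Section DegreeConstrained.
Variable T : finType.
Implicit Types (e H : rel T) (S : {set T}).

Lemma degE H x : deg H x = \sum_y H x y.
Proof. by rewrite /deg -sum1dep_card big_mkcond. Qed.

Lemma subset_of_card S k : k <= #|S| -> exists2 S' : {set T}, S' \subset S & #|S'| = k.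
Proof.
move=> kS; exists [set x in take k (enum S)].
  by apply/subsetP => x; rewrite inE => /mem_take; rewrite mem_enum.
rewrite cardsE (card_uniqP _) ?take_uniq ?enum_uniq // size_takel //.
by rewrite -cardE.
Qed.

(** Symmetric difference of [H] with the star from [u] to [S], so that inserting and deleting edges
    are one operation. *)
Definition star H u S : rel T :=
  fun a b => H a b (+) ((a == u) && (b \in S) || (b == u) && (a \in S)).

Lemma star_simple H u S : simple_graph H -> u \notin S -> simple_graph (star H u S).
Proof.
move=> [symH irrH] uS; split=> [a b|a]; rewrite /star; first by rewrite symH orbC.
by rewrite irrH orbb; case: eqP => // ->; rewrite (negPf uS).
Qed.

Lemma sum_star u S w :
  \sum_y ((w == u) && (y \in S)) + \sum_y ((y == u) && (w \in S))
  = (w == u) * #|S| + (w \in S).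
Proof.
congr addn.
  rewrite -sum1_card big_distrr big_mkcond /= [RHS]big_mkcond /=.
  by apply: eq_bigr => y _; case: (w == u); case: (y \in S).
rewrite (bigD1 u) //= eqxx big1 ?addn0 //.
by move=> y /negPf->.
Qed.

Lemma deg_star_add H u S w : simple_graph H -> u \notin S ->
  (forall z, z \in S -> ~~ H u z) ->
  deg (star H u S) w = deg H w + ((w == u) * #|S| + (w \in S)).
Proof.
move=> [symH irrH] uS nH; rewrite !degE -sum_star -!big_split /=.
apply: eq_bigr => y _; rewrite /star.
case: (eqVneq w u) => [->|wu] /=; last case: (eqVneq y u) => [->|yu] /=.
- rewrite (negPf uS) !andbF orbF; have := nH y.
  by case: (y \in S) => [/(_ isT)/negPf->|_] //; rewrite addbF !addn0.
- rewrite symH; have := nH w.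
  by case: (w \in S) => [/(_ isT)/negPf->|_] //; rewrite addbF !addn0.
- by rewrite addbF !addn0.
Qed.

Lemma deg_star_del H u S w : simple_graph H -> u \notin S ->
  (forall z, z \in S -> H u z) ->
  deg (star H u S) w + ((w == u) * #|S| + (w \in S)) = deg H w.
Proof.
move=> [symH irrH] uS nH; rewrite !degE -sum_star -!big_split /=.
apply: eq_bigr => y _; rewrite /star.
case: (eqVneq w u) => [->|wu] /=; last case: (eqVneq y u) => [->|yu] /=.
- rewrite (negPf uS) !andbF orbF; have := nH y.
  by case: (y \in S) => [/(_ isT)->|_] //; rewrite addbF !addn0.
- rewrite symH; have := nH w.
  by case: (w \in S) => [/(_ isT)->|_] //; rewrite addbF !addn0.
- by rewrite addbF !addn0.
Qed.

Variables (e : rel T) (lo hi : T -> nat).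
Hypothesis sge : simple_graph e.
Hypothesis lohi : forall v, lo v < hi v.
(** Each of these four bounds serves one case of [counting_contradiction]: [dhi] and [hilo] a vertex
    above its target [hi] or [lo], [hid] and [lod] a low vertex with target [hi] or [lo]. All four
    hold if [lo v] lies between a third and a half of the degree and [hi v] between a half and two
    thirds. *)
Hypothesis lod : forall v, 2 * lo v <= deg e v.
Hypothesis dhi : forall v, deg e v <= 2 * hi v + 1.
Hypothesis hilo : forall v, hi v <= 2 * lo v + 3.
Hypothesis hid : forall v, 2 * hi v <= deg e v + lo v + 2.

(* [s] chooses between the two targets of each vertex. *)
Definition tgt (s : pred T) v := if s v then hi v else lo v.

(** Exceeding the target by 1 is allowed, as both values are admissible in the end; what remains is
    to bring [deficit] down to 0. *)
Definition valid (s : pred T) H :=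
  [/\ simple_graph H, subrel H e & forall v, deg H v <= (tgt s v).+1].

Definition deficit (s : pred T) H := \sum_v (tgt s v - deg H v).

Section Step.
Variables (s : pred T) (H : rel T) (v0 : T).
Hypothesis vH : valid s H.
Hypothesis v0d : deg H v0 < tgt s v0.
Hypothesis best : forall s' H', valid s' H' -> deficit s H <= deficit s' H'.

Let sgH : simple_graph H. Proof. by case: vH. Qed.
Let subH : subrel H e. Proof. by case: vH. Qed.
Let degH v : deg H v <= (tgt s v).+1. Proof. by case: vH. Qed.

Lemma no_improvement s' H' v1 : valid s' H' ->
  (forall v, tgt s' v - deg H' v <= tgt s v - deg H v) ->
  tgt s' v1 - deg H' v1 < tgt s v1 - deg H v1 -> False.
Proof.
move=> v' le lt; have := best v'; rewrite /deficit leqNgt => /negP; apply.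
rewrite (bigD1 v1) //= [X in _ < X](bigD1 v1) //= -addSn leq_add //.
by apply: leq_sum.
Qed.

Definition low v := deg H v <= tgt s v.

(* Alternating walks leave low vertices along non-edges of H, the others along edges
   of H; for an optimal (s, H), low and other vertices alternate ([flip_edge]). *)
Definition astep u z := if low u then e u z && ~~ H u z else H u z.

Let low0 : low v0. Proof. by rewrite /low ltnW. Qed.

Lemma astep_edge u z : astep u z -> e u z.
Proof. by rewrite /astep; case: ifP => _ => [/andP[]|/subH]. Qed.

Lemma e_neq u z : e u z -> u != z.
Proof. by move=> euz; apply/eqP => uz; move: euz; rewrite uz (proj2 sge). Qed.

Lemma star1_sub H' u S : subrel H' e -> (forall z, z \in S -> e u z) ->
  subrel (star H' u S) e.
Proof.
move=> sub eS a b; rewrite /star; case: (boolP (H' a b)) => [/sub -> //|_] /=.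
case/orP => /andP[/eqP-> zS]; first exact: eS.
by rewrite (proj1 sge) eS.
Qed.

(** Along the path non-edges and edges alternate, so inner vertices keep their degree and [v0] gains
    1; the end gains 1 if it is not low and loses 1 if it is low. At the end only the edge to its
    predecessor [pr] changes, hence the counts of edges there change by at most 1. *)
Lemma flip p : path astep v0 p -> uniq (v0 :: p) ->
  path (fun u z => low u != low z) v0 p ->
  exists H', [/\ simple_graph H', subrel H' e,
    forall a b, H' a b != H a b ->
      [&& a \in v0 :: p, b \in v0 :: p & low a != low b],
    forall w, deg H' w + (w == last v0 p) * low (last v0 p) =
              deg H w + (w == v0) + (w == last v0 p) * ~~ low (last v0 p) &
    exists pr, forall b,
      H' (last v0 p) b = H (last v0 p) b (+) ((last v0 p != v0) && (b == pr))].
Proof.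
elim/last_ind: p => [|p z IH].
  move=> _ _ _; exists H; split=> //=.
  - by move=> a b; rewrite eqxx.
  - by move=> w; rewrite low0 muln0 addn0 muln1.
  - by exists v0 => b; rewrite eqxx addbF.
rewrite !rcons_path last_rcons -rcons_cons rcons_uniq => /andP[pp st].
move=> /andP[zp up] /andP[ap alt].
have [H' [sg' sub' diff' dg' _]] := IH pp up ap.
set l := last v0 p in st alt dg' *.
have lp : l \in v0 :: p by rewrite mem_last.
have lz : l \notin [set z] by rewrite inE e_neq // astep_edge.
have nz a b : (a == z) || (b == z) -> H' a b = H a b.
  move=> ab; apply/eqP; apply: contraT => /diff' /and3P[a1 b1 _].
  by case/orP: ab => /eqP E; subst; rewrite ?a1 ?b1 in zp.
exists (star H' l [set z]); split.
- exact: star_simple.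
- by apply: star1_sub => // y; rewrite inE => /eqP->; apply: astep_edge.
- move=> a b; rewrite /star !inE !mem_rcons !(in_cons z).
  case: (boolP (H' a b == H a b)) => [/eqP->|].
    have [|] := boolP ((a == l) && (b == z) || (b == l) && (a == z)); last first.
      by rewrite addbF eqxx.
    move=> + _; case/orP => /andP[/eqP-> /eqP->].
      by move: lp; rewrite inE eqxx alt !orbT => /orP[]->; rewrite ?orbT.
    by move: lp; rewrite inE eqxx (eq_sym (low z)) alt !orbT => /orP[]->; rewrite ?orbT.
  move=> /diff' /and3P[]; rewrite !inE => /orP[]-> /orP[]-> ->;
  by rewrite ?orbT.
- move=> w; have := dg' w.
  move: st alt; rewrite /astep; case lowl: (low l) => /=.
    case/andP=> elz nHlz; case lowz: (low z) => //= _.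
    rewrite deg_star_add // ?cards1 ?inE; last first.
      by move=> y; rewrite inE => /eqP->; rewrite nz ?eqxx ?orbT.
    by lia_goal.
  move=> Hlz; case lowz: (low z) => //= _ E.
  have nH y : y \in [set z] -> H' l y.
    by rewrite inE => /eqP->; rewrite nz ?eqxx ?orbT.
  have := deg_star_del w sg' lz nH; rewrite cards1 inE; move: E; lia_goal.
- exists l => b; have zv : z != v0 by apply: contraNneq zp => ->; rewrite inE eqxx.
  rewrite /star nz ?eqxx // zv !inE eqxx andbT.
  congr (_ (+) _); case: (b == l); rewrite ?orbT ?orbF //.
  by apply/negP => /andP[/eqP zl]; move: lz; rewrite zl inE eqxx.
Qed.

(** Otherwise flipping the path together with the step to [z] lowers the deficit: a low [z] can take
    one more edge, another [z] can spare one. It does no harm if [z] is on the path, as [flip]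
    changes no edge between vertices of the same kind. *)
Lemma flip_edge p z : path astep v0 p -> uniq (v0 :: p) ->
  path (fun u z => low u != low z) v0 p ->
  astep (last v0 p) z -> low (last v0 p) != low z.
Proof.
move=> pp up ap; have [H' [sg' sub' diff' dg' _]] := flip pp up ap.
set l := last v0 p in dg' * => st; apply/eqP => lowE.
have elz := astep_edge st.
have lz : l \notin [set z] by rewrite inE e_neq.
have Hlz : H' l z = H l z.
  by apply/eqP; apply: contraT => /diff' /and3P[_ _]; rewrite lowE eqxx.
have zz y : y \in [set z] -> y = z by rewrite inE => /eqP.
have sg2 := star_simple sg' lz.
have sub2 : subrel (star H' l [set z]) e.
  by apply: star1_sub => // y /zz->.
move: st; rewrite /astep; case lowl: (low l).
  case/andP=> _ nH; have dd w : deg (star H' l [set z]) w =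
      deg H w + (w == v0) + (w == z).
    rewrite deg_star_add // ?cards1 ?inE; last by move=> y /zz->; rewrite Hlz.
    have := dg' w; rewrite lowl /=; lia_goal.
  apply: (@no_improvement s (star H' l [set z]) v0).
  - split=> // w; rewrite dd; have := degH w.
    have lz' : deg H z <= tgt s z by rewrite -/(low z) -lowE.
    move: lz'; case: (eqVneq w z) => [->|wz]; case: eqVneq => [wv|_] /=; try lia_goal.
    + by have := v0d; rewrite -wv; lia_goal.
    + by have := v0d; rewrite -wv; lia_goal.
  - by move=> w; rewrite dd; lia_goal.
  - by rewrite dd eqxx; have := v0d; lia_goal.
move=> Hl; have nH y : y \in [set z] -> H' l y by move=> /zz->; rewrite Hlz.
have dd w : deg (star H' l [set z]) w + (w == z) = deg H w + (w == v0).
  have := deg_star_del w sg' lz nH; rewrite cards1 inE.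
  have := dg' w; rewrite lowl /=; lia_goal.
have hz : tgt s z < deg H z by rewrite ltnNge -/(low z) -lowE lowl.
have zv : z != v0 by apply: contraTneq hz => ->; rewrite -leqNgt ltnW.
apply: (@no_improvement s (star H' l [set z]) v0).
- split=> // w; have := dd w; have := degH w.
  case: (eqVneq w v0) => [->|_] /=; last lia_goal.
  by have := v0d; lia_goal.
- move=> w; have := dd w; case: (eqVneq w z) => [->|_] /=; last lia_goal.
  move: hz; lia_goal.
- by have := dd v0; rewrite eqxx eq_sym (negPf zv); have := v0d; lia_goal.
Qed.

Lemma alternating p : path astep v0 p -> uniq (v0 :: p) ->
  path (fun u z => low u != low z) v0 p.
Proof.
elim/last_ind: p => // p z IH; rewrite -rcons_cons rcons_uniq !rcons_path.
move=> /andP[pp st] /andP[_ up]; rewrite (IH pp up) /=.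
exact: (flip_edge pp up (IH pp up) st).
Qed.

Definition reach := [set v | connect astep v0 v].

Lemma flip_to u : u \in reach ->
  exists H', [/\ simple_graph H', subrel H' e,
    forall w, deg H' w + (w == u) * low u =
              deg H w + (w == v0) + (w == u) * ~~ low u &
    exists pr, forall b, H' u b = H u b (+) ((u != v0) && (b == pr))].
Proof.
rewrite inE => /connectP[p pp ->].
case/shortenP: pp => p' pp up _.
have [H' [sg' sub' _ dg' pr]] := flip pp up (alternating pp up).
by exists H'; split.
Qed.

Lemma reach_step u z : u \in reach -> astep u z ->
  (z \in reach) && (low z != low u).
Proof.
rewrite !inE => c st; rewrite (connect_trans c (connect1 st)) /=.
case/connectP: c => p pp E; move: st; rewrite E.
case/shortenP: pp => p' pp up _ st.
by rewrite eq_sym (flip_edge pp up (alternating pp up) st).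
Qed.

Definition Xs := [set v in reach | ~~ low v].
Definition Ys := [set v in reach | low v].
Definition kx x := #|[set y in Ys | e x y && ~~ H x y]|.
Definition ky y := #|[set x in Xs | H y x]|.

(** If [x] had more missing edges to [Ys], its target could be switched to [hi x]: flipping a path
    to [x] brings its degree to [lo x + 2], and new edges to low vertices, which can all take one,
    bring it up to [hi x]. Meanwhile [v0] has gained. *)
Lemma kx_bound x : x \in Xs -> ~~ s x -> kx x + lo x + 2 <= hi x.
Proof.
rewrite inE => /andP[xr lx] sx; rewrite leqNgt; apply/negP => kb.
have [H' [sg' sub' dg' [pr prE]]] := flip_to xr.
have xv : x != v0 by apply: contraNneq lx => ->.
rewrite xv /= in prE.
have dx : deg H x = (lo x).+1.
  move: lx (degH x); rewrite /low /tgt (negPf sx); lia_goal.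
pose Nx := [set y in Ys | e x y && ~~ H' x y].
have kN : (kx x).-1 <= #|Nx|.
  rewrite /kx (cardsD1 pr); apply: (@leq_trans #|Nx :\ pr|); last first.
    exact: (subset_leq_card (subsetDl _ _)).
  apply: (@leq_trans #|[set y in Ys | e x y && ~~ H x y] :\ pr|).
    by rewrite -subn1 leq_subLR leq_add2r; case: (pr \in _).
  apply: subset_leq_card; apply/subsetP => y; rewrite !inE.
  by case/and3P=> yp -> /andP[-> h]; rewrite yp prE (negPf yp) addbF.
have [|S SN Sk] := @subset_of_card Nx (hi x - (lo x + 2)).
  by apply: leq_trans kN; move: kb; lia_goal.
have SP y : y \in S -> [/\ low y, e x y & ~~ H' x y].
  by move/(subsetP SN); rewrite !inE => /and3P[/andP[_ ->] -> ->].
have xS : x \notin S.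
  by apply/negP => /SP[_]; rewrite (proj2 sge).
have dd w := @deg_star_add H' x S w sg' xS (fun y yS => let: And3 _ _ h := SP y yS in h).
have d1 w : deg (star H' x S) w =
    deg H w + (w == v0) + (w == x) * (1 + (hi x - (lo x + 2))) + (w \in S).
  rewrite dd Sk; have := dg' w; rewrite (negPf lx) /=; have := lohi x.
  by case: (w == x) => /=; lia_goal.
pose s' : pred T := fun w => (w == x) || s w.
have tE w : w != x -> tgt s' w = tgt s w by rewrite /tgt /s' => /negPf->.
have tx : tgt s' x = hi x by rewrite /tgt /s' eqxx.
have tx0 : tgt s x = lo x by rewrite /tgt (negPf sx).
apply: (@no_improvement s' (star H' x S) v0).
- split=> [|a b ab|w].
  + exact: star_simple.
  + by move: ab; apply: star1_sub => // y /SP[].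
  + rewrite d1; case: (eqVneq w x) => [->|wx].
      by rewrite tx (negPf xS) (negPf xv) dx; have := lohi x; lia_goal.
    rewrite tE //; case: (boolP (w \in S)) => [/SP[lw _ _]|_]; last first.
      have := degH w; case: eqVneq => [->|_] /=; last lia_goal.
      by have := v0d; lia_goal.
    move: lw; rewrite /low; case: eqVneq => [->|_] /=; last lia_goal.
    by have := v0d; lia_goal.
- move=> w; rewrite d1; case: (eqVneq w x) => [->|wx].
    by rewrite tx (negPf xS) (negPf xv) dx; lia_goal.
  by rewrite tE //; lia_goal.
- rewrite d1 eqxx tE 1?eq_sym //; have := v0d; lia_goal.
Qed.

(** Dual to [kx_bound]: otherwise the target of [y] is switched to [lo y], and edges to [Xs], whose
    vertices all exceed their target by 1, are deleted until the degree is low enough. *)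
Lemma ky_bound y : y \in Ys -> s y -> ky y + lo y + 2 <= deg H y.
Proof.
rewrite inE => /andP[yr ly] sy; rewrite leqNgt; apply/negP => kb.
pose s' : pred T := fun w => (w != y) && s w.
have tE w : w != y -> tgt s' w = tgt s w by rewrite /tgt /s' => ->.
have ty : tgt s' y = lo y by rewrite /tgt /s' eqxx.
have ty0 : tgt s y = hi y by rewrite /tgt sy.
have dy : deg H y <= hi y by rewrite -ty0.
(* Here switching the target alone already reduces the shortfall of [y]. *)
have [/andP[c1 c2]|c] := boolP ((deg H y <= (lo y).+1) && (deg H y < hi y)).
  apply: (@no_improvement s' H y).
  - split=> // w; case: (eqVneq w y) => [->|wy]; first by rewrite ty.
    by rewrite tE.
  - move=> w; case: (eqVneq w y) => [->|wy]; last by rewrite tE.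
    rewrite ty ty0; have := lohi y; lia_goal.
  - rewrite ty ty0; move: c1 c2; have := lohi y; lia_goal.
have [H' [sg' sub' dg' [pr prE]]] := flip_to yr.
have dy' : deg H' y + 1 = deg H y + (y == v0).
  by have := dg' y; rewrite eqxx ly /=; lia_goal.
have yv0 : y = v0 -> deg H y < hi y by move=> E; rewrite -ty0 E v0d.
pose Nx := [set x in Xs | H' y x].
have kN : ky y <= #|Nx| + (y != v0).
  rewrite /ky; case: (eqVneq y v0) prE => [yv|yv] prE /=.
    rewrite addn0 subset_leq_card //; apply/subsetP => x; rewrite !inE prE.
    by rewrite addbF.
  rewrite (cardsD1 pr) addnC leq_add //; last by case: (_ \in _).
  apply: subset_leq_card; apply/subsetP => x; rewrite !inE prE.
  by case/and3P=> /negPf-> -> ->.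
have [|S SN Sk] := @subset_of_card Nx (deg H' y - (lo y + 1)).
  move: kN kb dy' c; have := lohi y.
  case: eqVneq => [E|_] /=; last lia_goal.
  by have := yv0 E; lia_goal.
have SP x : x \in S -> ~~ low x /\ H' y x.
  by move/(subsetP SN); rewrite !inE => /andP[/andP[_ ->] ->].
have yS : y \notin S.
  by apply/negP => /SP[_]; rewrite (proj2 sg').
have dd w := @deg_star_del H' y S w sg' yS (fun x xS => proj2 (SP x xS)).
have lod' : lo y < deg H y.
  by move: c; rewrite negb_and -!ltnNge; have := lohi y; lia_goal.
have dS x : x \in S -> deg H' x = (tgt s x).+1.
  move=> xS; have [lx _] := SP _ xS.
  have xv : x != v0 by apply: contraNneq lx => ->.
  have xy : x != y by apply: contraNneq lx => ->.
  have := dg' x; rewrite (negPf xv) (negPf xy) /= !addn0 => ->.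
  by apply/eqP; rewrite eqn_leq degH ltnNge -/(low x) lx.
have d1 w : w != y -> w \notin S -> deg (star H' y S) w = deg H w + (w == v0).
  move=> wy wS; have := dd w; have := dg' w.
  by rewrite (negPf wy) (negPf wS) /=; lia_goal.
have d2 w : w \in S -> deg (star H' y S) w = tgt s w.
  move=> wS; have := dd w; rewrite dS // wS.
  have -> : w == y = false by apply: contraNF yS => /eqP <-.
  by lia_goal.
have d3 : lo y <= deg (star H' y S) y <= (lo y).+1.
  have := dd y; rewrite eqxx Sk (negPf yS).
  have := lod'; have := dy'; move: dy; case: (y == v0) => /=; lia_goal.
have tS w : w \in S -> tgt s' w = tgt s w.
  by move=> wS; rewrite tE //; apply: contraNneq yS => <-.
apply: (@no_improvement s' (star H' y S) v0).
- split=> [|a b ab|w].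
  + exact: star_simple.
  + by move: ab; apply: star1_sub => // x /SP[_] /sub'.
  + case: (eqVneq w y) => [->|wy]; first by rewrite ty; case/andP: d3.
    case: (boolP (w \in S)) => [wS|wS]; first by rewrite d2 // tS.
    rewrite d1 // tE //; case: eqVneq => [->|_] /=; last by rewrite addn0.
    by have := v0d; lia_goal.
- move=> w; case: (eqVneq w y) => [->|wy]; first by rewrite ty; move: d3; lia_goal.
  case: (boolP (w \in S)) => [wS|wS]; first by rewrite d2 // tS // subnn.
  by rewrite d1 // tE //; lia_goal.
- case: (eqVneq v0 y) => [E|vy].
    by rewrite E ty ty0; move: (yv0 (esym E)) d3; lia_goal.
  rewrite d1 ?tE ?eqxx //; last by apply/negP => /SP[]; rewrite low0.
  by have := v0d; lia_goal.
Qed.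

Lemma sum_set_card (A : {set T}) (P : pred T) :
  #|[set y in A | P y]| = \sum_(y in A) P y.
Proof. by rewrite -sum1dep_card big_mkcondr. Qed.

(* Every H-edge at Xs and every non-H-edge at Ys joins Xs to Ys.  Counting these two
   kinds of edges from both sides with [kx_bound] and [ky_bound], each kind turns out
   to be at most the other one, strictly so because of [v0]. *)
Lemma counting_contradiction : False.
Proof.
have v0Y : v0 \in Ys by rewrite !inE connect0 low0.
have nonE y : deg e y = deg H y + #|[set z | e y z && ~~ H y z]|.
  rewrite !degE -sum1dep_card [X in _ + X]big_mkcond -big_split /=.
  apply: eq_bigr => z _; have := @subH y z.
  by case: (H y z) => [-> //|_]; case: (e y z).
have EH : \sum_(x in Xs) deg H x = \sum_(y in Ys) ky y.
  transitivity (\sum_(x in Xs) \sum_(y in Ys) H x y).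
    apply: eq_bigr => x xX; rewrite -sum_set_card /deg; congr #|pred_of_set _|.
    apply/setP => y; rewrite !inE; case Hxy: (H x y); last by rewrite andbF.
    move: xX; rewrite inE => /andP[xr lx].
    have := @reach_step x y xr; rewrite /astep (negPf lx) => /(_ Hxy).
    by rewrite inE => /andP[->]; case: (low y).
  rewrite exchange_big; apply: eq_bigr => y _; rewrite /ky sum_set_card.
  by apply: eq_bigr => x _; rewrite (proj1 sgH).
have EN : \sum_(y in Ys) (deg e y - deg H y) = \sum_(x in Xs) kx x.
  transitivity (\sum_(y in Ys) \sum_(x in Xs) (e y x && ~~ H y x)).
    apply: eq_bigr => y yY; rewrite -sum_set_card nonE addKn.
    congr #|pred_of_set _|; apply/setP => x; rewrite !inE.
    case Hxy: (e y x && _); last by rewrite andbF.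
    move: yY; rewrite inE => /andP[yr ly].
    have := @reach_step y x yr; rewrite /astep ly => /(_ Hxy).
    by rewrite inE => /andP[->]; case: (low x).
  rewrite exchange_big; apply: eq_bigr => x _; rewrite /kx sum_set_card.
  by apply: eq_bigr => y _; rewrite (proj1 sgH) (proj1 sge).
have le1 : \sum_(x in Xs) kx x <= \sum_(x in Xs) deg H x.
  apply: leq_sum => x xX; have := degH x; have lx : ~~ low x.
    by move: xX; rewrite inE => /andP[].
  move: (lx); rewrite /low -ltnNge; have := dhi x; have := hilo x.
  case: (boolP (s x)) => sx.
    have : kx x <= deg e x - deg H x.
      rewrite nonE addKn; apply: subset_leq_card; apply/subsetP => y.
      by rewrite !inE => /andP[].
    rewrite /tgt sx; lia_goal.
  have := kx_bound xX sx; rewrite /tgt (negPf sx); lia_goal.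
have kyd y : ky y <= deg H y.
  by apply: subset_leq_card; apply/subsetP => x; rewrite !inE => /andP[].
have lt2 y : y \in Ys -> ky y + (y == v0) <= deg e y - deg H y.
  move=> yY; have ly : low y by move: yY; rewrite inE => /andP[].
  have := kyd y; have := lod y; have := hid y; have := v0d.
  move: ly; rewrite /low; case: (boolP (s y)) => sy.
    have := ky_bound yY sy; rewrite /tgt sy.
    by case: eqVneq => [<-|_] /=; rewrite ?sy; lia_goal.
  rewrite /tgt (negPf sy).
  by case: eqVneq => [<-|_] /=; rewrite ?(negPf sy); lia_goal.
have : \sum_(y in Ys) ky y < \sum_(y in Ys) (deg e y - deg H y).
  have <- : \sum_(y in Ys) (ky y + (y == v0)) = (\sum_(y in Ys) ky y).+1.
    rewrite big_split /= (bigD1 v0 v0Y) /= [X in _ + X](bigD1 v0 v0Y) /= eqxx.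
    by rewrite [X in 1 + X]big1 ?addn1 // => y /andP[_ /negPf->].
  exact: leq_sum.
by rewrite EN -EH ltnNge le1.
Qed.
End Step.

(* Addario-Berry, Dalal, McDiarmid, Reed and Thomason. *)
Theorem degree_constrained_subgraph :
  exists H, [/\ simple_graph H, subrel H e &
    forall v, deg H v \in [:: lo v; (lo v).+1; hi v; (hi v).+1]].
Proof.
have [s [H [vH best]]] : exists s H, valid s H /\
    forall s' H', valid s' H' -> deficit s H <= deficit s' H'.
  have : exists k s H, valid s H /\ deficit s H <= k.
    exists (deficit xpred0 (fun _ _ => false)), xpred0, (fun _ _ => false).
    split=> //; split=> // v; rewrite /deg.
    by rewrite (_ : [set _ | _] = set0) ?cards0 //; apply/setP=> y; rewrite !inE.
  case=> k; elim: k => [|k IH] [s [H [vH dk]]].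
    by exists s, H; split=> // s' H' _; rewrite (leq_trans dk).
  have [/IH //|nk] := EM (exists s H, valid s H /\ deficit s H <= k).
  exists s, H; split=> // s' H' v'; apply: (leq_trans dk).
  by rewrite ltnNge; apply/negP => le; apply: nk; exists s', H'.
exists H; have [sgH subH degH] := vH; split=> // v.
have : tgt s v <= deg H v.
  by rewrite leqNgt; apply/negP => /(counting_contradiction vH); apply.
have := degH v; rewrite /tgt !inE; case: (s v); lia_goal.
Qed.
End DegreeConstrained.

(** * Assignments with bounded multiplicities *)

(** Greedy choice: if all values of [K j] were used [M] times, then [M * size (K j)] earlier
    elements would have lists meeting [K j], and [j] itself is one more. *)
Lemma list_assignment (J : finType) (A : {set J}) (K : J -> seq nat) (M : nat) :
  (forall j, j \in A -> uniq (K j)) -> (forall j, j \in A -> 0 < size (K j)) ->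
  (forall j, j \in A -> #|[set i in A | has (mem (K j)) (K i)]| <= M * size (K j)) ->
  exists f : J -> nat, (forall j, j \in A -> f j \in K j) /\
    forall k, #|[set j in A | f j == k]| <= M.
Proof.
move=> Ku K0 KM.
suff [f [fK fM]] : exists f : J -> nat, (forall j, j \in enum A -> f j \in K j) /\
    forall k, count (fun j => f j == k) (enum A) <= M.
  exists f; split=> [j jA|k]; first by rewrite fK ?mem_enum.
  by rewrite -sum1dep_card -big_enum_cond sum1_count.
have: {subset enum A <= A} by move=> j; rewrite mem_enum.
elim: (enum A) (enum_uniq A) => [|j s IH] /=; first by exists (fun=> 0).
case/andP=> js us sA; have [|f [fK fM]] := IH us.
  by move=> i si; rewrite sA // inE si orbT.
have jA : j \in A by rewrite sA // mem_head.
have [/hasP[k kK kM]|] := boolP (has (fun k => count (fun i => f i == k) s < M) (K j)).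
  exists (fun i => if i == j then k else f i); split=> [i|k'].
    rewrite inE; case: eqVneq => [-> //|_] /=; exact: fK.
  rewrite eqxx; have E : count (fun i => (if i == j then k else f i) == k') s =
      count (fun i => f i == k') s.
    by apply: eq_in_count => i /= si; case: (eqVneq i j) => // ij; rewrite -ij si in js.
  rewrite E; case: eqVneq => [<-|_] //=; exact: fM.
rewrite -all_predC => /allP all_full.
have : M * size (K j) <= \sum_(k <- K j) count (fun i => f i == k) s.
  rewrite -sum1_size big_distrr /= big_seq [X in _ <= X]big_seq.
  by apply: leq_sum => k /all_full /=; rewrite muln1 -leqNgt.
have -> : \sum_(k <- K j) count (fun i => f i == k) s = count (fun i => f i \in K j) s.
  elim: s {IH us fK js fM all_full sA} => [|i s IH] /=; first by rewrite big1.
  rewrite big_split /= IH; congr addn.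
  rewrite -(count_uniq_mem _ (Ku j jA)) -sum1_count [RHS]big_mkcond /=.
  by apply: eq_bigr => k _; rewrite eq_sym.
rewrite leqNgt => /negP; case; apply: leq_trans (KM j jA).
have us' : uniq (j :: [seq i <- s | f i \in K j]).
  by rewrite /= mem_filter negb_and js orbT filter_uniq.
rewrite -size_filter -[_.+1]/(size (j :: [seq i <- s | f i \in K j])).
rewrite -(card_uniqP us'); apply: subset_leq_card; apply/subsetP => i.
rewrite !inE => /orP[/eqP->|].
  rewrite jA; have := K0 j jA; case: (K j) => // k l _.
  by apply/hasP; exists k; apply: mem_head.
rewrite mem_filter => /andP[fi si]; rewrite sA ?inE ?si ?orbT //.
by apply/hasP; exists (f i) => //; apply: fK.
Qed.

(** Hall's condition for intervals, where [r] is the longest admissible wait: service in order of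
    arrival attains it. *)
Lemma queue_assignment (J : finType) (A : {set J}) (Z : J -> nat) (q r : nat) :
  (forall i j, i \in A -> j \in A -> Z i <= Z j ->
     #|[set v in A | Z i <= Z v <= Z j]| <= q * (Z j - Z i + 1 + r)) ->
  exists t : J -> nat, (forall v, v \in A -> Z v <= t v <= Z v + r) /\
    forall k, #|[set v in A | t v == k]| <= q.
Proof.
move=> ZA; case: (posnP q) => [q0|q0].
  have A0 v : v \notin A.
    apply/negP => vA; have := ZA _ _ vA vA (leqnn _).
    rewrite q0 mul0n leqn0 cards_eq0 => /eqP/setP/(_ v).
    by rewrite !inE vA leqnn.
  exists (fun=> 0); split=> [v|k]; first by rewrite (negPf (A0 v)).
  rewrite q0 leqn0 cards_eq0; apply/eqP/setP => v.
  by rewrite !inE (negPf (A0 v)).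
(* The customers [v] arrive at time [Z v] in the order of [key]; [pos v] is the first
   free place from [q * Z v] on in a queue serving [q] customers per unit of time. *)
pose key v := Z v * #|J| + enum_rank v.
have keyI : injective key.
  move=> u v /(congr1 (fun k => k %% #|J|)); rewrite !modnMDl !modn_small //.
  by move/val_inj/enum_rank_inj.
have keyZ u v : key u <= key v -> Z u <= Z v.
  have J0 : 0 < #|J| by apply/card_gt0P; exists u.
  move/(leq_div2r #|J|); rewrite !divnMDl // !divn_small //; lia.
pose idx v := #|[set u in A | key u < key v]|.
have idxlt u v : u \in A -> key u < key v -> idx u < idx v.
  move=> uA uv; apply: proper_card; apply/properP; split.
    by apply/subsetP => w; rewrite !inE => /andP[-> /= wu]; apply: ltn_trans uv.
  by exists u; rewrite !inE uA ?ltnn.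
pose pos v := \max_(w in A | key w <= key v) (q * Z w + (idx v - idx w)).
have poslt u v : u \in A -> v \in A -> key u < key v -> pos u < pos v.
  move=> uA vA uv; have iuv := idxlt _ _ uA uv.
  have [|w /andP[wA wu]] := @eq_bigmax_cond _ [pred w | (w \in A) && (key w <= key u)]
      (fun w => q * Z w + (idx u - idx w)).
    by apply/card_gt0P; exists u; rewrite !inE uA leqnn.
  rewrite -/(pos u) => ->.
  have wv : (w \in A) && (key w <= key v) by rewrite wA (leq_trans wu) // ltnW.
  apply: leq_trans (@leq_bigmax_cond _ _ (fun w => q * Z w + (idx v - idx w)) _ wv).
  have : idx w <= idx u.
    apply: subset_leq_card; apply/subsetP => x; rewrite !inE => /andP[-> /= xw].
    exact: leq_trans wu.
  move: iuv; clear; lia.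
exists (fun v => pos v %/ q); split=> [v vA|k].
  have vv : (v \in A) && (key v <= key v) by rewrite vA leqnn.
  apply/andP; split.
    rewrite leq_divRL // mulnC.
    apply: leq_trans (@leq_bigmax_cond _ _ (fun w => q * Z w + (idx v - idx w)) _ vv).
    by rewrite subnn addn0.
  rewrite -ltnS ltn_divLR // -addnS.
  (* The maximiser [w] opens the busy period in which [v] is served; all those served from [w] to
     [v] arrived between [Z w] and [Z v], so the hypothesis bounds their number. *)
  have [|w /andP[wA wv]] := @eq_bigmax_cond _ [pred w | (w \in A) && (key w <= key v)]
      (fun w => q * Z w + (idx v - idx w)).
    by apply/card_gt0P; exists v; rewrite !inE vA leqnn.
  rewrite -/(pos v) => ->.
  have Zwv := keyZ _ _ wv; have := ZA _ _ wA vA Zwv.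
  have : idx v - idx w + 1 <= #|[set u in A | Z w <= Z u <= Z v]|.
    rewrite addn1 (cardsD1 v) !inE vA Zwv leqnn ltnS leq_subLR /idx.
    apply: leq_trans (leq_card_setU _ _).
    apply: subset_leq_card; apply/subsetP => u; rewrite !inE => /andP[uA uv].
    rewrite uA /=; case: ltnP => //= wu.
    by rewrite !keyZ ?(ltnW uv) // !andbT; apply: contraTneq uv => ->; rewrite ltnn.
  move: Zwv; clear -q0; nia.
pose S := [set v in A | pos v %/ q == k].
have Sq (v : J) : v \in S -> pos v - q * k < q.
  rewrite inE => /andP[_ /eqP <-]; have := ltn_ceil (pos v) q0; lia.
have posI : {in A &, injective pos}.
  move=> u v uA vA E; apply: keyI; case: (ltngtP (key u) (key v)) => // lt.
    by have := poslt _ _ uA vA lt; rewrite E ltnn.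
  by have := poslt _ _ vA uA lt; rewrite E ltnn.
rewrite -[X in _ <= X]card_ord -/S.
have [/eqP-> //|/set0Pn[v0 v0S]] := boolP (S == set0); first by rewrite cards0.
pose f v : 'I_q := Ordinal (ltn_pmod (pos v - q * k) q0).
rewrite -(@card_in_imset _ _ f S) ?max_card //.
move=> u v uS vS /(congr1 val) /=; rewrite !modn_small ?Sq //.
move: uS vS; rewrite !inE => /andP[uA /eqP uk] /andP[vA /eqP vk] E.
apply: posI => //; move: (leq_trunc_div (pos u) q) (leq_trunc_div (pos v) q).
by rewrite uk vk; move: E; clear; lia.
Qed.

(** * Concentration *)

Lemma card_bigcup_le (I T : finType) (P : pred I) (F : I -> {set T}) :
  #|\bigcup_(i | P i) F i| <= \sum_(i | P i) #|F i|.
Proof.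
elim/big_rec2: _ => [|i m A _ le]; first by rewrite cards0.
by rewrite cardsU (leq_trans (leq_subr _ _)) // leq_add2l.
Qed.

Section Hoeffding.
Local Open Scope ring_scope.
Variable R : realType.

Lemma expR_le_quad (y : R) : y <= 2^-1 -> expR y <= 1 + y + 2 * y ^+ 2.
Proof.
move=> y2; have e1 : 1 - y <= expR (- y) by apply: expR_ge1Dx.
have p1 : 0 < 1 - y by lra.
have -> : expR y = (expR (- y))^-1 by rewrite expRN invrK.
apply: (@le_trans _ _ (1 - y)^-1); first by rewrite lef_pV2 ?posrE // (lt_le_trans p1).
rewrite -[_^-1]mul1r ler_pdivrMr //; nra.
Qed.

Variables V T : finType.
Hypothesis T0 : (0 < #|T|)%N.
Implicit Types (U : {set V}) (f : V -> T -> R).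

Lemma exp_moment U f (lam : R) :
  (forall v, \sum_t f v t = 0) -> (forall v t, `|f v t| <= 1) ->
  0 <= lam <= 2^-1 ->
  \sum_(w : {ffun V -> T}) expR (lam * \sum_(v in U) f v (w v))
    <= #|{ffun V -> T}|%:R * expR (2 * lam ^+ 2 * #|U|%:R).
Proof.
move=> f0 f1 /andP[l0 l1].
pose G v t := if v \in U then expR (lam * f v t) else 1.
have GE (w : {ffun V -> T}) :
    expR (lam * \sum_(v in U) f v (w v)) = \prod_v G v (w v).
  by rewrite mulr_sumr expR_sum big_mkcond.
rewrite (eq_bigr _ (fun w _ => GE w)).
(* Independence: a sum over functions of a product is the product of the sums. *)
rewrite -bigA_distr_bigA /= card_ffun natrX.
have -> : #|T|%:R ^+ #|V| * expR (2 * lam ^+ 2 * #|U|%:R) =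
    \prod_v (#|T|%:R * if v \in U then expR (2 * lam ^+ 2) else 1).
  rewrite big_split /= prodr_const; congr (_ * _).
  by rewrite -big_mkcond /= prodr_const expRM_natr.
apply: ler_prod => v _; apply/andP; split.
  by apply: sumr_ge0 => t _; rewrite /G; case: ifP => // _; apply: expR_ge0.
rewrite /G; case: ifP => _; last by rewrite sumr_const mulr1.
apply: (@le_trans _ _ (\sum_t (1 + lam * f v t + 2 * lam ^+ 2))).
  apply: ler_sum => t _; have := f1 v t; rewrite ler_norml => /andP[h1 h2].
  apply: (le_trans (expR_le_quad _)); first by nra.
  have : (f v t) ^+ 2 <= 1 by nra.
  rewrite exprMn; have : 0 <= lam ^+ 2 by apply: sqr_ge0.
  by move: (lam ^+ 2) (f v t ^+ 2) => a b; nra.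
rewrite !big_split /= -mulr_sumr f0 mulr0 addr0 !sumr_const -mulrnDl.
by rewrite -[leLHS]mulr_natl ler_wpM2l // expR_ge1Dx.
Qed.

Lemma tail_bound U f (kappa : R) :
  (forall v, \sum_t f v t = 0) -> (forall v t, `|f v t| <= 1) ->
  0 <= kappa <= 1 ->
  #|[set w : {ffun V -> T} | kappa * #|U|%:R < \sum_(v in U) f v (w v)]|%:R
    <= #|{ffun V -> T}|%:R * expR (- (kappa ^+ 2 * #|U|%:R / 8)) :> R.
Proof.
move=> f0 f1 /andP[k0 k1]; set B := [set w | _].
(* [lam = kappa / 4] minimises the exponent [2 * lam ^+ 2 - lam * kappa], whose minimum is
   [- kappa ^+ 2 / 8]. *)
have l01 : 0 <= kappa / 4 <= 2^-1 by lra.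
have := exp_moment U f0 f1 l01; set E := \sum_w _ => EB.
set u : R := #|U|%:R in EB *.
have : #|B|%:R * expR (kappa / 4 * (kappa * u)) <= E.
  rewrite /E (bigID (mem B)) /= -[X in X <= _]addr0 lerD //; last first.
    by apply: sumr_ge0 => w _; apply: expR_ge0.
  rewrite -sum1_card natr_sum mulr_suml; apply: ler_sum => w.
  rewrite inE => /ltW wB; rewrite mul1r ler_expR ler_wpM2l //.
  by case/andP: l01.
move/le_trans => /(_ _ EB); rewrite -ler_pdivlMr ?expR_gt0 //.
rewrite -expRN -[leRHS]mulrA -expRD => /le_trans; apply.
rewrite ler_wpM2l // ler_expR; lra.
Qed.

Definition mean (g : pred T) : R := #|[set t | g t]|%:R / #|T|%:R.

Lemma mean_bounds g : 0 <= mean g <= 1.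
Proof.
rewrite /mean divr_ge0 //= ler_pdivrMr ?ltr0n // mul1r ler_nat.
exact: max_card.
Qed.

(** Each [j] and each sign fails on a fraction of at most [expR (- L)] of the [w], and there are
    [2 * #|J|] such pairs. A lower bound [D] on the sizes is enough because the allowed error is
    proportional to the size. *)
Lemma uniform_deviation (J : finType) (g : J -> V -> T -> bool)
    (U : J -> {set V}) (D : nat) (kappa L : R) :
  0 <= kappa <= 1 -> 8 * L <= kappa ^+ 2 * D%:R ->
  (forall j, D <= #|U j|)%N -> (2 * #|J|)%:R < expR L ->
  exists w : {ffun V -> T}, forall j,
    `|\sum_(v in U j) (g j v (w v))%:R - \sum_(v in U j) mean (g j v)|
      <= kappa * #|U j|%:R.
Proof.
move=> kap LD DU JL.
have Tn0 : #|T|%:R != 0 :> R by rewrite pnatr_eq0 -lt0n.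
pose f j v t : R := (g j v t)%:R - mean (g j v).
have f0 j v : \sum_t f j v t = 0.
  rewrite /f sumrB sumr_const -mulr_natr /mean divfK //.
  by rewrite -natr_sum -sum1dep_card [in X in _ - X]big_mkcond subrr.
have f1 j v t : `|f j v t| <= 1.
  have /andP[h0 h1] := mean_bounds (g j v).
  by rewrite /f ler_norml; case: (g j v t) => /=; lra.
pose B (sg : bool) j := [set w : {ffun V -> T} |
   kappa * #|U j|%:R < \sum_(v in U j) (-1) ^+ sg * f j v (w v)].
have cardB sg j : #|B sg j|%:R <= #|{ffun V -> T}|%:R * expR (- L).
  apply: le_trans (@tail_bound (U j) (fun v t => (-1) ^+ sg * f j v t) _ _ _ kap) _.
  - by move=> v; rewrite -mulr_sumr f0 mulr0.
  - by move=> v t; rewrite normrM normr_sign mul1r.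
  rewrite ler_wpM2l // ler_expR lerN2.
  have : (D%:R : R) <= #|U j|%:R by rewrite ler_nat.
  move: kap => /andP[k0 _]; have := sqr_ge0 kappa.
  move: LD; move: (kappa ^+ 2) (#|U j|%:R : R) (D%:R : R) => a b c.
  by nra.
have [w wB|none] := pickP [pred w | w \notin \bigcup_(s : bool * J) B s.1 s.2].
  exists w => j; move: wB; rewrite /= => wB.
  have nB (sg : bool) : \sum_(v in U j) (-1) ^+ sg * f j v (w v) <= kappa * #|U j|%:R.
    rewrite leNgt; apply: contra wB => lt; apply/bigcupP.
    by exists (sg, j) => //; rewrite inE.
  rewrite -sumrB ler_norml; apply/andP; split.
    by have := nB true; rewrite -mulr_sumr expr1 mulN1r lerNl.
  by have := nB false; rewrite -mulr_sumr expr0 mul1r.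
have : #|{ffun V -> T}|%:R <= (2 * #|J|)%:R * (#|{ffun V -> T}|%:R * expR (- L)).
  apply: (@le_trans _ _ (\sum_(s : bool * J) #|B s.1 s.2|%:R)).
    rewrite -natr_sum ler_nat; apply: leq_trans (card_bigcup_le _ _).
    apply: subset_leq_card; apply/subsetP => x _; have := none x.
    by rewrite /= => /negbFE.
  apply: (@le_trans _ _ (\sum_(s : bool * J) (#|{ffun V -> T}|%:R * expR (- L)))).
    by apply: ler_sum => s _; apply: cardB.
  by rewrite sumr_const card_prod card_bool [leRHS]mulr_natl.
have O0 : 0 < #|{ffun V -> T}|%:R :> R.
  by rewrite card_ffun ltr0n expn_gt0 T0.
rewrite mulrCA -[leLHS]mulr1 ler_pM2l // expRN leNgt => /negP; case.
by rewrite ltr_pdivrMr ?expR_gt0 // mul1r.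
Qed.
End Hoeffding.

(** * Random labels *)

Lemma card_prod3 (a b c : nat) (P : pred 'I_a) (Q : pred 'I_b) (S : pred 'I_c) :
  #|[set t : 'I_a * 'I_b * 'I_c | [&& P t.1.1, Q t.1.2 & S t.2]]|
  = #|[set x | P x]| * #|[set x | Q x]| * #|[set x | S x]|.
Proof.
rewrite -!cardsX; congr #|pred_of_set _|; apply/setP => t.
by rewrite !inE andbA.
Qed.

Lemma card_ord_between N i j : #|[set x : 'I_N | i <= x <= j]| <= j.+1 - i.
Proof.
rewrite cardE -(size_map val) -(size_iota i (j.+1 - i)).
apply: uniq_leq_size; first by rewrite (map_inj_uniq val_inj) enum_uniq.
move=> k /mapP[x]; rewrite mem_enum inE => xb ->; rewrite mem_iota /=; lia.
Qed.

(** With levels in ['I_N] a vertex of level [k] keeps each edge with probability exactly [k / N]. *)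
Lemma card_ord_sum_ge N (k : 'I_N) : #|[set x : 'I_N | N <= k + x]| = k.
Proof.
apply/eqP; rewrite eqn_leq; apply/andP; split.
  apply: leq_trans (_ : #|[set x : 'I_N | N - k <= x <= N.-1]| <= _).
    by apply: subset_leq_card; apply/subsetP => x; rewrite !inE; have := ltn_ord x; lia.
  by apply: leq_trans (card_ord_between _ _ _) _; have := ltn_ord k; lia.
have : #|[set x : 'I_N | N <= k + x]| + #|~: [set x : 'I_N | N <= k + x]| = N.
  by rewrite cardsC card_ord.
have : #|~: [set x : 'I_N | N <= k + x]| <= N - k.
  apply: leq_trans (_ : #|[set x : 'I_N | 0 <= x <= (N - k).-1]| <= _).
    by apply: subset_leq_card; apply/subsetP => x; rewrite !inE; have := ltn_ord x; lia.
  by apply: leq_trans (card_ord_between _ _ _) _; have := ltn_ord k; lia.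
have := ltn_ord k; lia.
Qed.

(** Why [matching] uses a sum: the relation is symmetric, and every label matches exactly one of the
    [m] values, so F has density [1 / m] whatever the label of the vertex. *)
Lemma card_ord_sum_eq m (k : 'I_m) : #|[set x : 'I_m | k + x == m.-1]| = 1.
Proof.
rewrite -(cards1 (rev_ord k)); congr #|pred_of_set _|; apply/setP => x.
rewrite !inE -val_eqE /=; have := ltn_ord k; have := ltn_ord x; lia.
Qed.

Lemma card_ord_eq0 m : 0 < m -> #|[set x : 'I_m | x == 0 :> nat]| = 1.
Proof.
move=> m0; rewrite -(cards1 (Ordinal m0)); congr #|pred_of_set _|; apply/setP => x.
by rewrite !inE -val_eqE.
Qed.

Lemma card_set_predC (T : finType) (P : pred T) :
  #|[set x | ~~ P x]| = #|T| - #|[set x | P x]|.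
Proof.
rewrite -(cardsC [set x | P x]) addKn; congr #|pred_of_set _|.
by apply/setP => x; rewrite !inE.
Qed.

Lemma card_ord_real (R : realType) N (a b : R) : (a <= b + 1)%R ->
  (#|[set x : 'I_N | a <= x%:R <= b]%R|%:R <= b - a + 1)%R.
Proof.
move=> ab; have [->|/set0Pn[x0 x0S]] := eqVneq [set x : 'I_N | (a <= x%:R <= b)%R] set0.
  by rewrite cards0; lra.
have [x xS xmin] := arg_minnP (fun x : 'I_N => val x) x0S.
have [y yS ymax] := arg_maxnP (fun x : 'I_N => val x) x0S.
have := card_ord_between N x y; have xy : x <= y by apply: xmin.
set S := [set z | _] in x0S xS yS xmin ymax *; move=> cb.
have cS : #|S| <= y.+1 - x.
  apply: leq_trans cb; apply: subset_leq_card; apply/subsetP => z zS.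
  by rewrite inE; apply/andP; split; [apply: xmin|apply: ymax].
have : (#|S|%:R <= (y.+1 - x)%N%:R :> R)%R by rewrite ler_nat.
rewrite natrB; last by rewrite ltnW.
have xS' : x \in S := xS; have yS' : y \in S := yS.
rewrite -natr1; move: xS' yS'; rewrite !inE => /andP[h1 h2] /andP[h3 h4].
by move: h1 h4; move: (x%:R)%R (y%:R)%R => u v; lra.
Qed.

Section Labels.
Variables levels m : nat.
Hypothesis levels_gt0 : 0 < levels.
Hypothesis m_gt0 : 0 < m.

Definition label := ('I_levels * 'I_m * 'I_m)%type.
Implicit Types t : label.

(* The threshold variable [t.1.1 / levels]; the membership in B; the label that selects
   the set F of matching pairs. *)
Definition special t := t.1.2 == 0 :> nat.
Definition matching t t' := t.2 + t'.2 == m.-1 :> nat.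
Definition above t t' := levels <= t.1.1 + t'.1.1.

Lemma matching_sym : symmetric matching.
Proof. by move=> t t'; rewrite /matching addnC. Qed.
Lemma above_sym : symmetric above.
Proof. by move=> t t'; rewrite /above addnC. Qed.

Local Open Scope ring_scope.
Variable R : realType.
Let mu : R := m%:R^-1.
Let y t : R := t.1.1%:R / levels%:R.

Let mR : m%:R != 0 :> R. Proof. by rewrite pnatr_eq0 -lt0n. Qed.

Let NR : levels%:R != 0 :> R. Proof. by rewrite pnatr_eq0 -lt0n levels_gt0. Qed.

Lemma card_label : #|{: label}| = (levels * m * m)%N.
Proof. by rewrite /label !card_prod !card_ord. Qed.

Lemma meanE (P : pred 'I_levels) (Q S : pred 'I_m) (g : pred label) :
  (forall t, g t = [&& P t.1.1, Q t.1.2 & S t.2]) ->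
  mean R g = #|[set x | P x]|%:R / levels%:R *
    (#|[set x | Q x]|%:R * mu) * (#|[set x | S x]|%:R * mu).
Proof.
move=> gE; rewrite /mean card_label /mu.
rewrite (_ : [set t | g t] = [set t | [&& P t.1.1, Q t.1.2 & S t.2]]); last first.
  by apply/setP => t; rewrite !inE gE.
by rewrite card_prod3 !natrM; field; rewrite NR mR.
Qed.

Lemma mean_special : mean R special = mu.
Proof.
rewrite (@meanE xpredT (fun x => x == 0%N :> nat) xpredT) => [|t]; last by rewrite andbT.
by rewrite card_ord_eq0 // !cardsT !card_ord /mu; field; rewrite NR mR.
Qed.

Lemma mean_special_matching t0 :
  mean R (fun t => special t && matching t0 t) = mu ^+ 2.
Proof.
rewrite (@meanE xpredT (fun x => x == 0%N :> nat) (fun x => t0.2 + x == m.-1)%N) //.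
rewrite card_ord_eq0 // cardsT !card_ord card_ord_sum_eq /mu.
by field; rewrite NR mR.
Qed.

Lemma mean_nonspecial_matching t0 :
  mean R (fun t => ~~ special t && matching t0 t) = (1 - mu) * mu.
Proof.
rewrite (@meanE xpredT (fun x => x != 0%N :> nat) (fun x => t0.2 + x == m.-1)%N) //.
rewrite card_set_predC card_ord_eq0 // cardsT !card_ord card_ord_sum_eq natrB // /mu.
by field; rewrite NR mR.
Qed.

Lemma mean_above_nonspecial t0 :
  mean R (fun t => above t0 t && (~~ special t && ~~ matching t0 t))
  = y t0 * (1 - mu) ^+ 2.
Proof.
rewrite (@meanE (fun x => levels <= t0.1.1 + x)%N (fun x => x != 0%N :> nat)
  (fun x => t0.2 + x != m.-1)%N) //.
rewrite !card_set_predC card_ord_eq0 // card_ord_sum_ge card_ord_sum_eq !card_ord.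
by rewrite natrB // /mu /y; field; rewrite NR mR.
Qed.

Lemma mean_above t0 :
  mean R (fun t => above t0 t && ~~ (special t && matching t0 t))
  = y t0 * (1 - mu ^+ 2).
Proof.
have E1 : mean R (above t0) = y t0.
  rewrite (@meanE (fun x => levels <= t0.1.1 + x)%N xpredT xpredT) => [|t]; last first.
    by rewrite /= andbT.
  by rewrite card_ord_sum_ge !cardsT !card_ord /mu /y; field; rewrite NR mR.
have E2 : mean R (fun t => above t0 t && (special t && matching t0 t)) = y t0 * mu ^+ 2.
  rewrite (@meanE (fun x => levels <= t0.1.1 + x)%N (fun x => x == 0%N :> nat)
    (fun x => t0.2 + x == m.-1)%N) //.
  rewrite card_ord_sum_ge card_ord_eq0 // card_ord_sum_eq /mu /y.
  by field; rewrite NR mR.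
suff : mean R (above t0) = mean R (fun t => above t0 t && (special t && matching t0 t)) +
    mean R (fun t => above t0 t && ~~ (special t && matching t0 t)).
  by rewrite E1 E2 => E; rewrite mulrBr mulr1 {1}E addrC addKr.
rewrite /mean -mulrDl -natrD -cardsUI [X in (_ + #|pred_of_set X|)%N](_ : _ = set0).
  rewrite cards0 addn0; congr (_%:R / _); congr #|pred_of_set _|.
  by apply/setP => t; rewrite !inE -andb_orr orbN andbT.
by apply/setP => t; rewrite !inE andbACA andbN andbF.
Qed.

Lemma mean_interval (a b : R) (g : pred label) : a <= b + 1 ->
  (forall t, g t -> a <= t.1.1%:R <= b) ->
  mean R g <= (b - a + 1) / levels%:R.
Proof.
move=> ab gab; pose g' t := [&& (a <= t.1.1%:R <= b), true & true].
apply: (@le_trans _ _ (mean R g')).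
  rewrite /mean ler_wpM2r ?invr_ge0 // ler_nat subset_leq_card //.
  by apply/subsetP => t; rewrite !inE => /gab; rewrite /g' !andbT.
rewrite (@meanE (fun x => a <= x%:R <= b) xpredT xpredT) //.
rewrite !cardsT !card_ord /mu mulfV // !mulr1 ler_wpM2r ?invr_ge0 //.
exact: card_ord_real.
Qed.

Lemma mean_special_interval (a b : R) (g : pred label) : a <= b + 1 ->
  (forall t, g t -> special t && (a <= t.1.1%:R <= b)) ->
  mean R g <= (b - a + 1) / levels%:R * mu.
Proof.
move=> ab gab; pose g' t := [&& (a <= t.1.1%:R <= b), special t & true].
apply: (@le_trans _ _ (mean R g')).
  rewrite /mean ler_wpM2r ?invr_ge0 // ler_nat subset_leq_card //.
  by apply/subsetP => t; rewrite !inE => /gab; rewrite /g' andbT andbC.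
rewrite (@meanE (fun x => a <= x%:R <= b) (fun x => x == 0%N :> nat) xpredT) //.
rewrite card_ord_eq0 // !cardsT !card_ord /mu mulfV // mulr1 mul1r.
by rewrite ler_wpM2r ?invr_ge0 // ler_wpM2r ?invr_ge0 // card_ord_real.
Qed.
End Labels.

(** * The subgraph given by a labelling *)

Section Build.
Variables (V : finType) (e F Th : rel V) (B : {set V}) (Z : V -> nat) (r q M : nat).
Hypothesis sge : simple_graph e.
Hypothesis symF : symmetric F.
Hypothesis symTh : symmetric Th.

(* [nA] and [fA] count the settled edges and those at the disposal of a vertex of the
   complement of B; [nB], [fB] and [dB] count the settled edges, the edges at the
   disposal of the other end, and the edges inside B for a vertex of B. *)
Definition nA v := #|[set u | e v u && (Th v u && ~~ ((u \in B) && F v u))]|.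
Definition fA v := #|[set u | e v u && ((u \in B) && F v u)]|.
Definition nB v := #|[set u | e v u && (Th v u && ((u \notin B) && ~~ F v u))]|.
Definition fB v := #|[set u | e v u && ((u \notin B) && F v u)]|.
Definition dB v := #|[set u | e v u && (u \in B)]|.
Definition clash v := [set u in B |
  (nB u <= nB v + fB v + dB v) && (nB v <= nB u + fB u + dB u)].

Hypothesis ZA : forall v, v \notin B -> (nA v <= Z v) && (Z v + r <= nA v + fA v).
Hypothesis Zq : forall i j, Z i <= Z j ->
  #|[set u | Z i <= Z u <= Z j]| <= q * (Z j - Z i + 1 + r).
Hypothesis dB12 : forall v, v \in B -> 0 < dB v %/ 12.
Hypothesis clashM : forall v, v \in B -> 2 * #|clash v| <= M * (dB v %/ 12).

(** An edge of F between A and B is decided by its end in A alone, so these vertices reach the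
    degrees given by the queue independently of each other. This fixes the degrees outside the edges
    inside B, which finally move each vertex of B to one of its pairs. A degree [k] occurs at most
    [q] times in A and, since it determines its pair [k %/ 2], at most [M] times in B. *)
Lemma subgraph_of_partition : exists h : rel V, spanning_subgraph h e /\
  forall k, mult h k <= q + M.
Proof.
have [i j iA jA le|t [tZ tq]] := @queue_assignment V (~: B) Z q r.
  apply: leq_trans (Zq le); apply: subset_leq_card; apply/subsetP => u.
  by rewrite !inE => /andP[].
have Pex v : exists2 S : {set V}, S \subset [set u | e v u && ((u \in B) && F v u)] &
    v \notin B -> #|S| = t v - nA v.
  have [vB|vB] := boolP (v \in B); first by exists set0; rewrite ?sub0set.
  have [|S] := @subset_of_card V [set u | e v u && ((u \in B) && F v u)] (t v - nA v).
    rewrite -/(fA v); have := ZA vB; have := tZ v; rewrite inE vB => /(_ isT).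
    clear; lia.
  by exists S.
have [P PN Pk] := fin_all_exists2 Pex.
pose h0 u v := e u v && (if (u \in B) && (v \in B) then false else
  if ((u \in B) || (v \in B)) && F u v then
    (if v \in B then v \in P u else u \in P v) else Th u v).
have sym0 : symmetric h0.
  move=> u v; rewrite /h0 (proj1 sge) symF symTh.
  by case: (u \in B); case: (v \in B).
have degA v : v \notin B -> deg h0 v = t v.
  move=> vB; have := tZ v; rewrite inE vB => /(_ isT) tv.
  have -> : t v = nA v + #|P v|.
    by rewrite Pk //; move: tv (ZA vB); clear; lia.
  rewrite /deg /nA; set S := [set u | e v u && (_ && _)].
  rewrite -cardsUI.
  have -> : S :&: P v = set0.
    apply/setP => u; rewrite !inE; apply/negbTE/negP => /andP[/and3P[_ _ h1] uP].
    by move/subsetP/(_ u uP): (PN v); rewrite inE (negPf h1) andbF.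
  rewrite cards0 addn0; congr #|pred_of_set _|; apply/setP => u.
  rewrite !inE /h0 (negPf vB) /=; have := subsetP (PN v) u; rewrite inE.
  case: (boolP (u \in P v)) => [_ /(_ isT) /and3P[-> -> ->] //|_ _].
    by rewrite orbT.
  by case: (e v u); case: (u \in B); case: (F v u); case: (Th v u).
have degB v : v \in B -> nB v <= deg h0 v <= nB v + fB v.
  move=> vB; apply/andP; split.
    apply: subset_leq_card; apply/subsetP => u; rewrite !inE /h0 vB /=.
    by case/and4P=> -> -> /negPf-> /negPf->.
  rewrite /nB /fB -cardsUI (leq_trans _ (leq_addr _ _)) //.
  apply: subset_leq_card; apply/subsetP => u; rewrite !inE /h0 vB /=.
  by case: (e v u); case: (u \in B); case: (F v u); case: (Th v u).
pose D v := dB v.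
(* The item (v, b) is the lower or upper target pair {2k, 2k+1} of v in B. *)
pose K (j : V * bool) := iota ((deg h0 j.1 + D j.1 %/ (if j.2 then 2 else 3)) %/ 2 + 1)
   (D j.1 %/ 12).
(* Relative to [deg h0], the targets [2 * k] lie in [(D / 3, D / 2]] and [(D / 2, 2 * D / 3]], the
   windows suited to [degree_constrained_subgraph]; a width of [D / 6] has room for [D %/ 12] even
   numbers. *)
have KP j k : k \in K j -> deg h0 j.1 + D j.1 %/ (if j.2 then 2 else 3) < 2 * k /\
    2 * k <= deg h0 j.1 + D j.1 %/ (if j.2 then 2 else 3) + 2 * (D j.1 %/ 12).
  rewrite mem_iota; move: (deg _ _ + _) (D _ %/ 12) => a b; clear; lia.
have K2 j k : k \in K j -> deg h0 j.1 <= 2 * k <= deg h0 j.1 + D j.1.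
  by move/KP; move: (deg _ _) (D _) => a b; case: (j.2); clear; lia.
have [| | |f [fK fM]] := @list_assignment _ [set j | j.1 \in B] K M.
- by move=> j _; apply: iota_uniq.
- by move=> j; rewrite inE size_iota => /dB12.
- move=> j; rewrite inE => jB; rewrite size_iota.
  (* Items whose lists meet belong to clashing vertices, two items to each: hence the factor 2 in
     [clashM]. *)
  apply: leq_trans (clashM jB); rewrite mulnC -card_bool -cardsT -cardsX.
  apply: subset_leq_card; apply/subsetP => i; rewrite !inE andbT.
  case/andP=> iB /hasP[k kKi kKj]; rewrite iB /=.
  have arith (a b k' x y z x' y' z' : nat) : a <= k' <= a + z -> b <= k' <= b + z' ->
      x <= a <= x + y -> x' <= b <= x' + y' ->
      (x <= x' + y' + z') && (x' <= x + y + z) by clear; lia.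
  exact: arith (K2 _ _ kKi) (K2 _ _ kKj) (degB _ iB) (degB _ jB).
(* Outside B the degree in [eB] is 0, for which the defaults 0 and 1 satisfy all hypotheses. *)
pose lo v := if v \in B then 2 * f (v, false) - deg h0 v else 0.
pose hi v := if v \in B then 2 * f (v, true) - deg h0 v else 1.
pose eB : rel V := fun u v => [&& e u v, u \in B & v \in B].
have sgB : simple_graph eB.
  split=> [u v|u]; rewrite /eB; last by rewrite (proj2 sge).
  by rewrite (proj1 sge) [(u \in B) && _]andbC.
have dEB v : deg eB v = if v \in B then D v else 0.
  rewrite /deg /eB /D /dB; case: (v \in B); last first.
    by apply/eqP; rewrite cards_eq0; apply/eqP/setP => u; rewrite !inE andbF.
  by congr #|pred_of_set _|; apply/setP => u; rewrite !inE.
have fP v b : v \in B -> deg h0 v + D v %/ (if b then 2 else 3) < 2 * f (v, b) /\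
    2 * f (v, b) <= deg h0 v + D v %/ (if b then 2 else 3) + 2 * (D v %/ 12).
  by move=> vB; apply: (@KP (v, b)); apply: fK; rewrite inE.
have [||||| H [sgH subH dH]] := @degree_constrained_subgraph V eB lo hi sgB;
  try (move=> v; rewrite ?dEB /lo /hi; case: ifP => // vB;
       move: (fP v true vB) (fP v false vB); rewrite /=;
       move: (f _) (f _) (deg h0 v) (D v) (dB12 vB); clear; lia).
pose h : rel V := fun u v => h0 u v || H u v.
have degh v : deg h v = deg h0 v + deg H v.
  rewrite /deg -cardsUI.
  have -> : [set y | h0 v y] :&: [set y | H v y] = set0.
    apply/setP => u; rewrite !inE; apply/negbTE/negP => /andP[] + /subH /and3P[_ vB uB].
    by rewrite /h0 vB uB andbF.
  by rewrite cards0 addn0; congr #|pred_of_set _|; apply/setP => u; rewrite !inE.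
exists h; split.
  split; first split.
  - by move=> u v; rewrite /h sym0 (proj1 sgH).
  - by move=> u; rewrite /h /h0 (proj2 sge) (proj2 sgH).
  by move=> u v /orP[/andP[]//|/subH/andP[]].
move=> k; apply: leq_trans (leq_add (tq k) (fM (k %/ 2))).
rewrite /mult; apply: (@leq_trans #|[set v in ~: B | t v == k] :|:
   fst @: [set j | (j \in [set j : V * bool | j.1 \in B]) && (f j == k %/ 2)]|); last first.
  by rewrite (leq_trans (leq_card_setU _ _)) // leq_add2l leq_imset_card.
apply: subset_leq_card; apply/subsetP => v; rewrite !inE degh.
have [vB|vB] /= := boolP (v \in B); last first.
  have -> : deg H v = 0.
    apply/eqP; rewrite cards_eq0; apply/eqP/setP => u; rewrite !inE.
    by apply/negbTE/negP => /subH; rewrite /eB (negPf vB) andbF.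
  by rewrite addn0 degA // => ->.
move=> /eqP dk; apply/imsetP.
suff [b fb] : exists b, f (v, b) = k %/ 2.
  by exists (v, b) => //; rewrite !inE vB fb eqxx.
have := dH v; rewrite /lo /hi vB !inE -dk.
move: (fP v true vB) (fP v false vB) => /=.
move: (deg H v) (deg h0 v) => x y P1 P2 /or4P[]/eqP->.
- by exists false; move: P2; clear; lia.
- by exists false; move: P2; clear; lia.
- by exists true; move: P1; clear; lia.
- by exists true; move: P1; clear; lia.
Qed.
End Build.

(** * A good labelling exists *)

Section Sample.
Local Open Scope ring_scope.
Variables (R : realType) (V : finType) (e : rel V) (delta m q M : nat) (L : R).
Hypothesis sge : simple_graph e.
Hypothesis V0 : (0 < #|V|)%N.
Hypothesis degd : forall v, (delta <= deg e v)%N.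
Hypothesis m1 : (1 < m)%N.
Hypothesis md : (120 * m ^ 2 <= delta)%N.
Let n := #|V|.
Let N := (20 * m ^ 2)%N.
Let mu : R := m%:R^-1.
(** The unit of error, equal to [1 / N]: rounding the threshold variable costs as much as the random
    deviation. The window of a vertex of A has about [mu ^+ 2 * d v] edges, that is 20 units
    [kap * d v]; [slot_available] spends them. *)
Let kap : R := mu ^+ 2 / 20.
Hypothesis Ld : 8 * L <= kap ^+ 2 * delta%:R.
Hypothesis JL : (2 * (n * (N * m * m) * 6 + n.+1 * n.+1))%:R < expR L.
Hypothesis hq : (n * m ^ 2 <= q * delta * (m ^ 2 - 1))%N.
Hypothesis hM : (400 * n <= M * delta * m)%N.

Let m0 : (0 < m)%N. Proof. exact: ltnW. Qed.
Let mR : m%:R != 0 :> R. Proof. by rewrite pnatr_eq0 -lt0n. Qed.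
Let mu_gt0 : 0 < mu. Proof. by rewrite invr_gt0 ltr0n. Qed.
Let mu_le : mu <= 2^-1. Proof. by rewrite lef_pV2 ?posrE ?ltr0n // ler_nat. Qed.
Let N0 : (0 < N)%N. Proof. by rewrite /N muln_gt0 expn_gt0 m0. Qed.
Let NE : N%:R^-1 = kap. Proof. by rewrite /N /kap /mu natrM natrX; field. Qed.
Let kap_gt0 : 0 < kap. Proof. by rewrite -NE invr_gt0 ltr0n. Qed.
Let kap_le : kap <= 80^-1. Proof. by have := mu_gt0; have := mu_le; rewrite /kap; nra. Qed.
Let d v : R := (deg e v)%:R.
Let del : R := delta%:R.
Let kapd : 6 <= kap * del.
Proof.
have : (120 * m ^ 2)%:R <= del by rewrite ler_nat.
rewrite natrM natrX => h.
have -> : kap * del = del / (20 * m%:R ^+ 2) by rewrite /kap /mu; field.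
have : 0 < m%:R ^+ 2 :> R by rewrite exprn_gt0 ?ltr0n.
move: (m%:R ^+ 2) h => a h a0; rewrite ler_pdivlMr; lra.
Qed.
Let del_gt0 : 0 < del. Proof. by have := kapd; have := kap_gt0; nra. Qed.
Let dd v : del <= d v. Proof. by rewrite ler_nat. Qed.

Local Notation lab := (label N m).
Let X (t : lab) : R := t.1.1%:R.
Let Y (t : lab) : R := t.1.1%:R / N%:R.

(* The least integer above y * (1 - mu^2) * d(u) + kap * d(u), where y = t.1.1 / N: up to
   kap * d(u), the first term is the number of settled edges at u outside B. *)
Definition slot u (t : lab) :=
  ((20 * (m ^ 2 - 1) * t.1.1 + N) * deg e u %/ (20 * N * m ^ 2) + 1)%N.

(** A relaxation of [clash] that reads only the labels of the two vertices, so that its count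
    concentrates. The radius is that of [B_interval] scaled by [N]. *)
Definition near v t0 u (t : lab) :=
  special t && (`|X t * d u - X t0 * d v| <= 3 * mu * N%:R * (d u + d v)).

(* The label [t0] stands for the label of [v] itself. *)
Definition event (j : V * lab * 'I_6 + 'I_n.+1 * 'I_n.+1) (u : V) (t : lab) : bool :=
  match j with
  | inl (v, t0, i) =>
    match val i with
    | 0 => above t0 t && ~~ (special t && matching t0 t)
    | 1 => special t && matching t0 t
    | 2 => above t0 t && (~~ special t && ~~ matching t0 t)
    | 3 => ~~ special t && matching t0 t
    | 4 => special t
    | _ => near v t0 u t
    end
  | inr (s, s') => (s <= slot u t <= s')%N
  end.

Definition range (j : V * lab * 'I_6 + 'I_n.+1 * 'I_n.+1) : {set V} :=
  match j with
  | inl (v, _, i) => if (i < 5)%N then [set u | e v u] else setT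
  | inr _ => setT
  end.

Let degn v : (deg e v < n)%N.
Proof.
rewrite /n -cardsT; apply: proper_card; apply/properP; split; first exact: subsetT.
by exists v; rewrite ?inE // (proj2 sge).
Qed.

(** A union bound over all [t0] replaces conditioning on the label of [v]: for fixed [t0] the events
    at different [u] are independent, and afterwards [t0] is taken to be [w v]. *)
Lemma good_labelling : exists w : {ffun V -> lab}, forall j,
  `|\sum_(v in range j) (event j v (w v))%:R - \sum_(v in range j) mean R (event j v)|
      <= kap * #|range j|%:R.
Proof.
apply: (@uniform_deviation R V lab _ _ event range delta kap L) => //.
- by rewrite card_label (muln_gt0 (N * m)) (muln_gt0 N) N0 m0.
- by rewrite ltW //=; have := kap_le; lra.
- case=> [[[v t0] i]|[s s']] /=; last first.
    by rewrite cardsT; case/card_gt0P: V0 => v _; rewrite (leq_trans (degd v)) // ltnW.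
  case: ifP => _; first exact: degd.
  by rewrite cardsT (leq_trans (degd v)) // ltnW.
- apply: le_lt_trans JL; rewrite ler_nat leq_mul2l /=.
  by rewrite card_sum !card_prod !card_ord.
Qed.

Section Good.
Variable w : {ffun V -> lab}.
Hypothesis Hw : forall j,
  `|\sum_(v in range j) (event j v (w v))%:R - \sum_(v in range j) mean R (event j v)|
      <= kap * #|range j|%:R.

Lemma dev_nbr v (g : pred lab) (p : R) : mean R g = p ->
  `|\sum_(u in [set u | e v u]) (g (w u))%:R - \sum_(u in [set u | e v u]) mean R g|
      <= kap * #|[set u | e v u]|%:R ->
  (p - kap) * d v <= #|[set u | e v u && g (w u)]|%:R <= (p + kap) * d v.
Proof.
move=> ->; rewrite sumr_const -mulr_natr -/(deg e v) -/(d v).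
have -> : \sum_(u in [set u | e v u]) (g (w u))%:R = #|[set u | e v u && g (w u)]|%:R :> R.
  rewrite -natr_sum -sum1dep_card big_mkcondr /=; congr _%:R.
  by apply: eq_bigl => u; rewrite inE.
by rewrite ler_norml; move: (_%:R) => a; nra.
Qed.

Lemma dev_all (g : V -> pred lab) (p : R) : (forall u, mean R (g u) <= p) ->
  `|\sum_(u in setT) (g u (w u))%:R - \sum_(u in [set: V]) mean R (g u)|
      <= kap * #|[set: V]|%:R ->
  #|[set u | g u (w u)]|%:R <= (p + kap) * n%:R.
Proof.
move=> gp; rewrite cardsT -/n.
have -> : \sum_(u in setT) (g u (w u))%:R = #|[set u | g u (w u)]|%:R :> R.
  rewrite -natr_sum -sum1dep_card big_mkcond [in RHS]big_mkcond /=; congr _%:R.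
  by apply: eq_bigr => u; rewrite inE.
have : \sum_(u in [set: V]) mean R (g u) <= p * n%:R.
  apply: (@le_trans _ _ (\sum_(u in [set: V]) p)); first by apply: ler_sum.
  by rewrite sumr_const cardsT mulr_natr.
rewrite ler_norml; move: (\sum_(u in _) _) => b; move: (_%:R) => a; lra.
Qed.

Let B := [set v | special (w v)].
Let F : rel V := fun u v => matching (w u) (w v).
Let Th : rel V := fun u v => above (w u) (w v).

Let y v := Y (w v).

Lemma nA_bounds v :
  (y v * (1 - mu ^+ 2) - kap) * d v <= (nA e F Th B v)%:R
    <= (y v * (1 - mu ^+ 2) + kap) * d v.
Proof.
have <- : #|[set u | e v u && (above (w v) (w u) && ~~ (special (w u) && matching (w v) (w u)))]|
    = nA e F Th B v.
  by apply: eq_card => u; rewrite !inE.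
exact: dev_nbr (mean_above N0 m0 R (w v)) (Hw (inl (v, w v, @Ordinal 6 0 isT))).
Qed.

Lemma fA_bounds v :
  (mu ^+ 2 - kap) * d v <= (fA e F B v)%:R <= (mu ^+ 2 + kap) * d v.
Proof.
have <- : #|[set u | e v u && (special (w u) && matching (w v) (w u))]| = fA e F B v.
  by apply: eq_card => u; rewrite !inE.
exact: dev_nbr (mean_special_matching N0 m0 R (w v)) (Hw (inl (v, w v, @Ordinal 6 1 isT))).
Qed.

Lemma nB_bounds v :
  (y v * (1 - mu) ^+ 2 - kap) * d v <= (nB e F Th B v)%:R
    <= (y v * (1 - mu) ^+ 2 + kap) * d v.
Proof.
have <- : #|[set u | e v u && (above (w v) (w u) && (~~ special (w u) && ~~ matching (w v) (w u)))]|
    = nB e F Th B v.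
  by apply: eq_card => u; rewrite !inE.
exact: dev_nbr (mean_above_nonspecial N0 m0 R (w v)) (Hw (inl (v, w v, @Ordinal 6 2 isT))).
Qed.

Lemma fB_bounds v :
  ((1 - mu) * mu - kap) * d v <= (fB e F B v)%:R <= ((1 - mu) * mu + kap) * d v.
Proof.
have <- : #|[set u | e v u && (~~ special (w u) && matching (w v) (w u))]| = fB e F B v.
  by apply: eq_card => u; rewrite !inE.
exact: dev_nbr (mean_nonspecial_matching N0 m0 R (w v)) (Hw (inl (v, w v, @Ordinal 6 3 isT))).
Qed.

Lemma dB_bounds v :
  (mu - kap) * d v <= (dB e B v)%:R <= (mu + kap) * d v.
Proof.
have <- : #|[set u | e v u && special (w u)]| = dB e B v.
  by apply: eq_card => u; rewrite !inE.
exact: dev_nbr (mean_special N0 m0 R) (Hw (inl (v, w v, @Ordinal 6 4 isT))).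
Qed.

Let y01 v : 0 <= y v <= 1.
Proof.
rewrite divr_ge0 //= ler_pdivrMr ?ltr0n // mul1r ler_nat.
exact: ltnW.
Qed.

Lemma B_interval v :
  (y v - 3 * mu) * d v <= (nB e F Th B v)%:R /\
  (nB e F Th B v + fB e F B v + dB e B v)%:R <= (y v + 3 * mu) * d v.
Proof.
have /andP[a1 a2] := nB_bounds v; have /andP[_ b2] := fB_bounds v.
have /andP[_ c2] := dB_bounds v; have /andP[y0 y1] := y01 v.
have := mu_gt0; have := mu_le; have := kap_gt0; have := dd v; have := del_gt0.
have kE : 20 * kap = mu ^+ 2 by rewrite /kap; field.
rewrite !natrD; move: a1 a2 b2 c2 kE y0 y1.
move: (y v) (_%:R) (_%:R) (_%:R) (d v) => Y0 a b c D a1 a2 b2 c2 kE y0 y1 D0 dD k0 mu2 mu0.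
have D1 : 0 < D by lra.
split.
  apply: le_trans a1; rewrite ler_wpM2r ?ltW //; nra.
apply: (@le_trans _ _ ((Y0 * (1 - mu) ^+ 2 + kap + (1 - mu) * mu + kap + mu + kap) * D)).
  by lra.
rewrite ler_wpM2r ?ltW //; nra.
Qed.

(** Division by [d u] confines the level of [u] to an interval of length
    [6 * mu * N * (1 + d v / d u)]; being special contributes another factor [mu]. *)
Lemma mean_near v t0 u : mean R (near v t0 u) <= 13 * mu ^+ 2 * (d v / del).
Proof.
have du0 : 0 < d u by apply: lt_le_trans (dd u); exact: del_gt0.
have dv0 : 0 < d v by apply: lt_le_trans (dd v); exact: del_gt0.
have N0R : 0 < N%:R :> R by rewrite ltr0n.
pose S := 3 * mu * N%:R * (d u + d v).
have S0 : 0 < S by rewrite /S !mulr_gt0 // ?addr_gt0 // mu_gt0.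
apply: (@le_trans _ _ (((X t0 * d v + S) / d u - (X t0 * d v - S) / d u + 1) / N%:R * mu)).
  apply: mean_special_interval => //.
    rewrite -[X in _ <= _ + X](@divff _ (d u)) ?gt_eqF // -mulrDl ler_pM2r ?invr_gt0 //.
    by lra.
  move=> t /andP[-> /=]; rewrite -/S ler_distl => /andP[h1 h2].
  by rewrite ler_pdivrMr // ler_pdivlMr // h1 -/(X t); lra.
have -> : ((X t0 * d v + S) / d u - (X t0 * d v - S) / d u + 1) / N%:R * mu =
    mu * (6 * mu * (1 + d v / d u) + N%:R^-1).
  by rewrite /S; field; rewrite !gt_eqF.
have r1 : 1 <= d v / del by rewrite ler_pdivlMr ?mul1r ?dd // del_gt0.
have r2 : d v / d u <= d v / del.
  by rewrite ler_pM2l // lef_pV2 ?posrE ?dd // del_gt0.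
rewrite NE; have kE : 20 * kap = mu ^+ 2 by rewrite /kap; field.
have := mu_gt0; have := mu_le; move: r1 r2 kE kap_gt0.
move: (d v / del) (d v / d u) => r r'; move=> r1 r2 kE k0 mu2 mu0.
have h : 6 * mu * (1 + r') + kap <= 13 * mu * r by nra.
rewrite expr2; nra.
Qed.

Lemma near_count v :
  #|[set u | near v (w v) u (w u)]|%:R <= 14 * mu ^+ 2 * n%:R * (d v / del).
Proof.
have := dev_all (mean_near v (w v)) (Hw (inl (v, w v, @Ordinal 6 5 isT))).
move/le_trans; apply.
have r1 : 1 <= d v / del by rewrite ler_pdivlMr ?mul1r ?dd // del_gt0.
have n0 : 0 < n%:R :> R by rewrite ltr0n.
have kE : 20 * kap = mu ^+ 2 by rewrite /kap; field.
move: (d v / del) (n%:R) r1 n0 kE kap_gt0 => r nn r1 n0 kE k0.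
have -> : 14 * mu ^+ 2 * nn * r = (14 * mu ^+ 2 * r) * nn by ring.
rewrite ler_pM2r //.
have : mu ^+ 2 <= mu ^+ 2 * r by nra.
lra.
Qed.

Lemma clash_near v : clash e F Th B v \subset [set u | near v (w v) u (w u)].
Proof.
apply/subsetP => u; rewrite !inE => /and3P[uB h1 h2]; rewrite /near uB /=.
have [lu uu] := B_interval u; have [lv uv] := B_interval v.
have h1' := le_trans lu (le_trans _ uv); have h2' := le_trans lv (le_trans _ uu).
have {h1'} h1' : (y u - 3 * mu) * d u <= (y v + 3 * mu) * d v.
  by apply: h1'; rewrite ler_nat.
have {h2'} h2' : (y v - 3 * mu) * d v <= (y u + 3 * mu) * d u.
  by apply: h2'; rewrite ler_nat.
have N0R : 0 < N%:R :> R by rewrite ltr0n.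
have XE x : X (w x) = y x * N%:R by rewrite /y /Y /X divfK // gt_eqF.
rewrite !XE.
have -> : y u * N%:R * d u - y v * N%:R * d v = N%:R * (y u * d u - y v * d v) by ring.
have -> : 3 * mu * N%:R * (d u + d v) = N%:R * (3 * mu * (d u + d v)) by ring.
rewrite normrM gtr0_norm // ler_pM2l // ler_norml.
by move: (y u) (y v) (d u) (d v) h1' h2' => a b c f h1' h2'; lra.
Qed.

(** The constant 400 of [hM] is [28 / (7 / 100)]: twice the 14 of [near_count], against lists of
    length at least [7 / 100 * (mu * d v)], where [7 / 100 < 1 / 12] absorbs deviation and
    rounding. *)
Lemma dB12 v : (0 < dB e B v %/ 12)%N /\
  (2 * #|clash e F Th B v| <= M * (dB e B v %/ 12))%N.
Proof.
have /andP[b1 _] := dB_bounds v.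
have cn : #|clash e F Th B v|%:R <= 14 * mu ^+ 2 * n%:R * (d v / del) :> R.
  by apply: le_trans (near_count v); rewrite ler_nat subset_leq_card // clash_near.
move: b1 cn; set D := dB _ _ _; set C := #|_|; move=> b1 cn.
have Dd : (D%:R : R) <= 12 * (D %/ 12)%:R + 11.
  have : (D <= 12 * (D %/ 12) + 11)%N by clear; lia.
  by rewrite -(ler_nat R) natrD natrM.
have mud : 120 <= mu * d v.
  have h1 : 120 <= mu * (mu * del).
    by have := kapd; rewrite /kap expr2; lra.
  have md0 : 0 < mu * del by rewrite mulr_gt0 ?mu_gt0 ?del_gt0.
  have : mu * del <= mu * d v by rewrite ler_pM2l ?mu_gt0.
  by have := mu_le; move: md0 h1; move: (mu * del) => a; nra.
have kk : kap <= mu / 40.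
  have : mu * mu <= mu * 2^-1 by rewrite ler_pM2l ?mu_le ?mu_gt0.
  by rewrite /kap expr2; lra.
have D7 : 7 / 100 * (mu * d v) <= (D %/ 12)%:R.
  have : mu * d v * (39 / 40) <= D%:R.
    apply: le_trans b1.
    have : (mu / 40) * d v >= kap * d v.
      by rewrite ler_wpM2r // (le_trans (ltW del_gt0)) // dd.
    rewrite mulrBl [mu / 40 * _]mulrAC.
    by move: (mu * d v) (kap * d v) => x z; lra.
  by move: (mu * d v) mud (D%:R : R) Dd => a mud x Dd; lra.
split.
  by rewrite -(ltr_nat R); apply: lt_le_trans D7; lra.
rewrite -(ler_nat R) !natrM.
have hM' : 400 * mu * n%:R <= M%:R * del.
  have : (400 * n)%:R <= (M * delta * m)%:R :> R by rewrite ler_nat.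
  rewrite !natrM -/del => h.
  have := mu_gt0; have E : m%:R * mu = 1 by rewrite /mu mulfV.
  move: h E; move: (m%:R) (n%:R) (M%:R) => a b c h E mu0.
  have : 400 * b * mu <= c * del * a * mu by rewrite ler_pM2r.
  have -> : c * del * a * mu = c * del * (a * mu) by ring.
  by rewrite E mulr1; lra.
have : 28 * mu ^+ 2 * n%:R * (d v / del) <= M%:R * (7 / 100 * (mu * d v)).
  have -> : 28 * mu ^+ 2 * n%:R * (d v / del) = (400 * mu * n%:R) * (7 / 100 * mu * d v / del).
    by field; rewrite gt_eqF // del_gt0.
  have -> : M%:R * (7 / 100 * (mu * d v)) = (M%:R * del) * (7 / 100 * mu * d v / del).
    by field; rewrite gt_eqF // del_gt0.
  apply: ler_wpM2r => //; rewrite divr_ge0 ?(ltW del_gt0) //.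
  apply: mulr_ge0; last exact: le_trans (ltW del_gt0) (dd v).
  by apply: mulr_ge0; [lra | exact: ltW mu_gt0].
have : M%:R * (7 / 100 * (mu * d v)) <= M%:R * (D %/ 12)%:R by rewrite ler_wpM2l.
move: cn; move: (mu ^+ 2 * n%:R * (d v / del)) => a; lra.
Qed.
End Good.

Definition slack := (16 * delta %/ (20 * m ^ 2))%N.

Let mm_lt1 : 0 < 1 - mu ^+ 2.
Proof. by have := mu_gt0; have := mu_le; nra. Qed.

Lemma divn_real (a b : nat) : (0 < b)%N ->
  (a %/ b)%:R * b%:R <= a%:R :> R /\ a%:R < ((a %/ b)%:R + 1) * b%:R :> R.
Proof.
move=> b0; rewrite -natrM ler_nat leq_trunc_div natr1 -natrM ltr_nat.
by rewrite ltn_ceil.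
Qed.

Lemma slot_bounds u t :
  (slot u t)%:R - 1 <= (Y t * (1 - mu ^+ 2) + kap) * d u < (slot u t)%:R.
Proof.
rewrite /slot; set a := (_ * deg e u)%N; set b := (20 * N * m ^ 2)%N.
have b0 : (0 < b)%N by rewrite /b (muln_gt0 (20 * N)) muln_gt0 N0 expn_gt0 m0.
have bR : 0 < b%:R :> R by rewrite ltr0n.
have [h1 h2] := divn_real a b0.
have aE : a%:R = (Y t * (1 - mu ^+ 2) + kap) * d u * b%:R.
  rewrite /a /b (natrM _ _ (deg e u)) natrD natrM (natrM _ 20) natrB ?expn_gt0 ?m0 //.
  rewrite (natrM _ (20 * N)) (natrM _ 20 N) natrX /kap /mu /Y -/(d u).
  by field; rewrite mR pnatr_eq0 -lt0n N0.
move: h1 h2; rewrite aE natrD ler_pM2r // ltr_pM2r // => h1 h2.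
by rewrite addrK h1 h2.
Qed.

Lemma slot_le u t : (slot u t <= n)%N.
Proof.
rewrite /slot addn1; apply: leq_ltn_trans (degn u).
have b0 : (0 < 20 * N * m ^ 2)%N by rewrite (muln_gt0 (20 * N)) muln_gt0 N0 expn_gt0 m0.
rewrite -[X in (_ <= X)%N](mulnK (deg e u) b0); apply: leq_div2r; rewrite mulnC leq_mul2l.
apply/orP; right; have := ltn_ord t.1.1; move: (nat_of_ord t.1.1) N0 => x.
have : (0 < m ^ 2)%N by rewrite expn_gt0 m0.
by move: (m ^ 2)%N N => a b; clear; nia.
Qed.

Lemma slack_bounds : 15 * kap * del <= slack%:R <= 16 * kap * del.
Proof.
have b0 : (0 < 20 * m ^ 2)%N by [].
have bR : 0 < N%:R :> R by rewrite ltr0n.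
have [] := divn_real (16 * delta) b0; rewrite -/slack -/N natrM -/del.
have E : kap * N%:R = 1 by rewrite -NE mulVf // gt_eqF.
have -> : 16 * del = 16 * kap * del * N%:R.
  have -> : 16 * kap * del * N%:R = 16 * del * (kap * N%:R) by ring.
  by rewrite E mulr1.
by rewrite ler_pM2r // ltr_pM2r //; have := kapd; lra.
Qed.

Section Slots.
Variable w : {ffun V -> lab}.
Hypothesis Hw : forall j,
  `|\sum_(v in range j) (event j v (w v))%:R - \sum_(v in range j) mean R (event j v)|
      <= kap * #|range j|%:R.
Let B := [set v | special (w v)].
Let F : rel V := fun u v => matching (w u) (w v).
Let Th : rel V := fun u v => above (w u) (w v).

(** Of the 20 units [kap * d v], the deviations of [nA] and [fA] and the offset in [slot] take one
    each, and rounding up takes at most one more. The other 16 explain the constant in [slack]. *)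
Lemma slot_available v : (nA e F Th B v <= slot v (w v))%N &&
  (slot v (w v) + slack <= nA e F Th B v + fA e F B v)%N.
Proof.
have /andP[a1 a2] := nA_bounds Hw v; have /andP[b1 _] := fA_bounds Hw v.
have /andP[c1 c2] := slot_bounds v (w v); have /andP[_ s2] := slack_bounds.
have kE : 20 * kap = mu ^+ 2 by rewrite /kap; field.
move: (slot v (w v)) c1 c2 slack s2 => S c1 c2 r s2.
rewrite -!(ler_nat R) !natrD; apply/andP; split; first exact: ltW (le_lt_trans a2 c2).
have h : 1 + 16 * kap * del <= 17 * kap * d v.
  have : kap * del <= kap * d v by rewrite ler_pM2l // dd.
  have := kapd; lra.
have E : mu ^+ 2 * d v = 20 * (kap * d v) by rewrite -kE; ring.
move: a1 b1 c1 s2 h; rewrite !mulrDl !mulNr E; lra.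
Qed.

Lemma mean_slot (s s' : nat) u : (s <= s')%N ->
  mean R (fun t => (s <= slot u t <= s')%N) <=
    (s'%:R - s%:R + 1) / ((1 - mu ^+ 2) * del) + kap.
Proof.
move=> ss; have ssR : s%:R <= s'%:R :> R by rewrite ler_nat.
have du0 : 0 < d u by apply: lt_le_trans (dd u); exact: del_gt0.
have N0R : 0 < N%:R :> R by rewrite ltr0n.
have m10 := mm_lt1.
pose a : R := ((s%:R - 1) / d u - kap) * (N%:R / (1 - mu ^+ 2)).
pose b : R := (s'%:R / d u - kap) * (N%:R / (1 - mu ^+ 2)).
have baE : b - a = (s'%:R - s%:R + 1) / ((1 - mu ^+ 2) * d u) * N%:R.
  by rewrite /a /b; field; rewrite !gt_eqF.
have ba0 : 0 <= b - a.
  rewrite baE; apply: mulr_ge0; last exact: ltW.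
  by apply: divr_ge0; [lra | rewrite ltW // mulr_gt0].
apply: (@le_trans _ _ ((b - a + 1) / N%:R)).
  apply: mean_interval => //; first lra.
  move=> t /andP[h1 h2]; have /andP[z1 z2] := slot_bounds u t.
  have h1R : s%:R <= (slot u t)%:R :> R by rewrite ler_nat.
  have h2R : (slot u t)%:R <= s'%:R :> R by rewrite ler_nat.
  have XE : t.1.1%:R = Y t * (1 - mu ^+ 2) * (N%:R / (1 - mu ^+ 2)).
    by rewrite /Y; field; rewrite !gt_eqF.
  have c0 : 0 < N%:R / (1 - mu ^+ 2) by rewrite divr_gt0.
  rewrite XE /a /b !ler_pM2r // lerBlDr lerBrDr ler_pdivrMr // ler_pdivlMr //.
  by apply/andP; split; lra.
rewrite mulrDl mul1r baE mulfK ?gt_eqF // NE lerD2r.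
apply: ler_wpM2l; first lra.
by rewrite lef_pV2 ?posrE ?mulr_gt0 // ler_pM2l // dd.
Qed.

(** By [hq], [q] pays for the length of the interval. The excess [2 * kap * n], half from rounding
    and half from sampling, is covered by [q * slack], so that [q] needs no error term. *)
Lemma slot_count i j : (slot i (w i) <= slot j (w j))%N ->
  (#|[set u | slot i (w i) <= slot u (w u) <= slot j (w j)]%N|
     <= q * (slot j (w j) - slot i (w i) + 1 + slack))%N.
Proof.
set s := slot i _; set s' := slot j _ => ss.
have sn : (s < n.+1)%N by rewrite ltnS slot_le.
have sn' : (s' < n.+1)%N by rewrite ltnS slot_le.
have := dev_all (fun u => mean_slot u ss) (Hw (inr (Ordinal sn, Ordinal sn'))).
move: s s' ss {sn sn'} => s s' ss.
rewrite -(ler_nat R) natrM !natrD natrB // => /le_trans; apply.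
have m10 := mm_lt1; have n0 : 0 < n%:R :> R by rewrite ltr0n.
have nq : n%:R <= q%:R * ((1 - mu ^+ 2) * del).
  have : (n * m ^ 2)%:R <= (q * delta * (m ^ 2 - 1))%:R :> R by rewrite ler_nat.
  rewrite !natrM natrB ?expn_gt0 ?m0 // natrX -/del.
  have mm0 : 0 < m%:R ^+ 2 :> R by rewrite exprn_gt0 ?ltr0n.
  have -> : q%:R * del * (m%:R ^+ 2 - 1) = q%:R * ((1 - mu ^+ 2) * del) * m%:R ^+ 2.
    by rewrite /mu; field.
  by rewrite ler_pM2r.
have nq' : n%:R <= q%:R * del.
  apply: le_trans nq _; rewrite ler_wpM2l // ger_pMl ?del_gt0 //.
  by rewrite gerBl sqr_ge0.
have /andP[sl _] := slack_bounds.
have h1 : n%:R / ((1 - mu ^+ 2) * del) <= q%:R.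
  by rewrite ler_pdivrMr // mulr_gt0 // del_gt0.
have h2 : 2 * kap * n%:R <= q%:R * slack%:R.
  apply: (@le_trans _ _ (q%:R * (15 * kap * del))); last by rewrite ler_wpM2l.
  have := kap_gt0; move: nq' n0; move: (n%:R : R) (q%:R : R) => a b nq' n0 k0.
  have -> : b * (15 * kap * del) = 15 * kap * (b * del) by ring.
  by move: (b * del) nq' => x; nra.
have ssR : s%:R <= s'%:R :> R by rewrite ler_nat.
have h3 : (s'%:R - s%:R + 1) * (n%:R / ((1 - mu ^+ 2) * del)) <= (s'%:R - s%:R + 1) * q%:R.
  by rewrite ler_wpM2l //; lra.
have -> : ((s'%:R - s%:R + 1) / ((1 - mu ^+ 2) * del) + kap + kap) * n%:R =
   (s'%:R - s%:R + 1) * (n%:R / ((1 - mu ^+ 2) * del)) + 2 * kap * n%:R by ring.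
lra.
Qed.
End Slots.

Lemma sample_subgraph : exists h : rel V, spanning_subgraph h e /\
  forall k, (mult h k <= q + M)%N.
Proof.
have [w Hw] := good_labelling.
apply: (@subgraph_of_partition V e (fun u v => matching (w u) (w v)) (fun u v => above (w u) (w v))
  [set v | special (w v)] (fun v => slot v (w v)) slack) => //.
- by move=> u v; apply: matching_sym.
- by move=> u v; apply: above_sym.
- by move=> v _; apply: slot_available.
- exact: slot_count.
- by move=> v _; have [] := dB12 Hw v.
- by move=> v _; have [] := dB12 Hw v.
Qed.
End Sample.

(** * Product spaces and the second moment *)

Section ProductSpace.
Variables I T : finType.
Local Notation Om := {ffun I -> T}.
Implicit Types (w : Om) (D : {set I}).

Definition depends_on (A : Type) D (f : Om -> A) :=
  forall w w', {in D, w =1 w'} -> f w = f w'.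

Lemma independent_events D D' (f g : pred Om) : [disjoint D & D'] ->
  depends_on D f -> depends_on D' g ->
  #|[set w | f w && g w]| * #|{: Om}| <= #|[set w | f w]| * #|[set w | g w]|.
Proof.
move=> DD fD gD; pose mix w w' : Om := [ffun i => if i \in D then w i else w' i].
rewrite -[#|{: Om}|]cardsT -!cardsX.
(* Exchanging the coordinates outside [D] maps (w, w') with f w, g w to f, g separately. *)
pose phi (s : Om * Om) := (mix s.1 s.2, mix s.2 s.1).
have phiK : cancel phi phi.
  by case=> w w'; rewrite /phi /=; congr pair; apply/ffunP => i; rewrite !ffunE; case: (i \in D).
rewrite -(card_imset _ (can_inj phiK)); apply: subset_leq_card; apply/subsetP => s.
case/imsetP=> -[w w']; rewrite !inE /= andbT => /andP[fw gw] -> /=.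
rewrite -(fD w) ?fw => [|i iD]; last by rewrite ffunE iD.
rewrite -(gD w) ?gw // => i iD'; rewrite ffunE.
by rewrite (disjointFl DD).
Qed.

Lemma coincidence_bound p p' (g : T -> T) : p != p' ->
  #|[set w : Om | w p == g (w p')]| * #|T| <= #|{: Om}|.
Proof.
move=> pp'; rewrite -[#|T|]cardsT -[#|{: Om}|]cardsT -cardsX.
(* [w p] can be recovered from [w p'], so that it is free to record [x]. *)
pose upd (s : Om * T) : Om := [ffun i => if i == p then s.2 else s.1 i].
rewrite -(@card_in_imset _ _ upd); first exact: subset_leq_card (subsetT _).
case=> [w x] [w' x']; rewrite !inE !andbT /= => /eqP wp /eqP wp' E.
have Ei i : (if i == p then x else w i) = (if i == p then x' else w' i).
  by have := congr1 (fun f : Om => f i) E; rewrite !ffunE.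
have -> : x = x' by have := Ei p; rewrite eqxx.
congr pair; apply/ffunP => i; have := Ei i; case: eqVneq => // -> _.
rewrite wp wp'; have := Ei p'; rewrite eq_sym (negPf pp') => -> //.
Qed.
End ProductSpace.

Section Chebyshev.
Local Open Scope ring_scope.
Variables (R : realFieldType) (Om V : finType) (f : V -> pred Om) (dep : rel V).
Hypothesis ind : forall v v', ~~ dep v v' ->
  (#|[set w | f v w && f v' w]| * #|Om| <= #|[set w | f v w]| * #|[set w | f v' w]|)%N.
Hypothesis Om0 : (0 < #|Om|)%N.

Let p v : R := #|[set w | f v w]|%:R / #|Om|%:R.

(** Chebyshev's inequality: the covariances are nonpositive outside [dep] by [ind], and at most 1
    elsewhere. *)
Lemma second_moment (t : R) : 0 <= t ->
  #|[set w | \sum_v p v + t <= #|[set v | f v w]|%:R]|%:R * t ^+ 2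
    <= #|Om|%:R * #|[set s : V * V | dep s.1 s.2]|%:R.
Proof.
move=> t0; have OR : 0 < #|Om|%:R :> R by rewrite ltr0n.
have pE v : p v * #|Om|%:R = \sum_w (f v w)%:R.
  by rewrite /p divfK ?gt_eqF // -natr_sum -sum1dep_card big_mkcond.
have NE w : #|[set v | f v w]|%:R = \sum_v (f v w)%:R :> R.
  by rewrite -natr_sum -sum1dep_card big_mkcond.
pose Z w : R := \sum_v ((f v w)%:R - p v).
have ZE w : #|[set v | f v w]|%:R = \sum_v p v + Z w.
  by rewrite NE /Z sumrB addrC subrK.
apply: (@le_trans _ _ (\sum_w Z w ^+ 2)).
  rewrite (bigID (fun w => \sum_v p v + t <= #|[set v | f v w]|%:R)) /=.
  rewrite -[X in X <= _]addr0 lerD ?sumr_ge0 // => [|w _]; last exact: sqr_ge0.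
  rewrite -sum1dep_card natr_sum mulr_suml; apply: ler_sum => w.
  by rewrite ZE lerD2l => tZ; rewrite mul1r ler_sqr ?nnegrE // (le_trans t0).
pose C v v' : R := \sum_w ((f v w)%:R - p v) * ((f v' w)%:R - p v').
have -> : \sum_w Z w ^+ 2 = \sum_(s : V * V) C s.1 s.2.
  rewrite /C exchange_big; apply: eq_bigr => w _.
  rewrite expr2 /Z mulr_suml -(pair_big xpredT xpredT
    (fun v v' => ((f v w)%:R - p v) * ((f v' w)%:R - p v'))) /=.
  by apply: eq_bigr => v _; rewrite mulr_sumr.
have CE v v' : C v v' =
    #|[set w | f v w && f v' w]|%:R - p v * (p v' * #|Om|%:R).
  have E : \sum_w (f v w && f v' w)%:R = #|[set w | f v w && f v' w]|%:R :> R.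
    by rewrite -natr_sum -sum1dep_card [in RHS]big_mkcond.
  rewrite /C -E.
  under eq_bigr => w _ do rewrite mulrBl !mulrBr -natrM mulnb.
  rewrite !sumrB -mulr_suml -mulr_sumr -!pE sumr_const -mulr_natr.
  by rewrite -/(#|Om|) ; ring.
rewrite -sum1dep_card natr_sum mulr_sumr [leRHS]big_mkcond; apply: ler_sum => s _.
case: ifP => [_|/negbT/ind] /=.
  rewrite mulr1 CE; have p0 x : 0 <= p x by rewrite divr_ge0.
  apply: (@le_trans _ _ #|[set w | f s.1 w && f s.2 w]|%:R).
    by rewrite gerBl mulr_ge0 // mulr_ge0.
  by rewrite ler_nat max_card.
rewrite -(ler_nat R) !natrM => h; rewrite CE subr_le0.
rewrite -(ler_pM2r OR) (le_trans h) // /p.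
by rewrite le_eqVlt; apply/orP; left; apply/eqP; field; rewrite gt_eqF.
Qed.
End Chebyshev.

(** * Random threshold subgraphs *)

Section ThresholdSubgraph.
Variables (V : finType) (S : V -> {set V}) (N d : nat).
Hypothesis Sirr : forall v, v \notin S v.
Hypothesis Scard : forall v, #|S v| = d.
Local Notation Om := {ffun V * V -> 'I_N}.
Implicit Types (w : Om) (u v a b : V).

(* The vertex v owns the pairs v u with u in S v.  The variable of v is [w (v, v)], and
   [w (v, u)] replaces that of u when u does not own the pair too. *)
Definition arc w v u := N <= w (v, v) + (if v \in S u then w (u, u) else w (v, u)).
Definition thr w : rel V :=
  fun u v => (v \in S u) && arc w u v || (u \in S v) && arc w v u.

Lemma thr_sym w : symmetric (thr w).
Proof. by move=> u v; rewrite /thr orbC. Qed.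

Definition pos v a := if a == v then (v, v) else if v \in S a then (a, a) else (v, a).
(** Reversing the variable of [v] turns the threshold condition [N <= x + y] into the comparison
    [N - 1 - x < y]; the kept arcs owned by [v] are then counted by a rank among [d + 1] values. *)
Definition val_at w v a := if a == v then rev_ord (w (v, v)) else w (pos v a).
Definition star_at v := v |: S v.
Definition rank w v a := #|[set b in star_at v | val_at w v a < val_at w v b]|.
Definition rest w v := #|[set u | [&& u \notin S v, v \in S u & arc w u v]]|.

Lemma card_star_at v : #|star_at v| = d.+1.
Proof. by rewrite cardsU1 Sirr Scard. Qed.

Lemma pos2 v a : (pos v a).2 = a.
Proof. by rewrite /pos; case: eqVneq => // _; case: ifP. Qed.

Lemma S_neq u v : u \in S v -> u != v.
Proof. by move=> uv; apply: contraTneq uv => ->; apply: Sirr. Qed.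

Lemma arcE w v u : u \in S v -> arc w v u = (val_at w v v < val_at w v u).
Proof.
move=> uv; rewrite /arc /val_at /pos eqxx (negPf (S_neq uv)) /=.
have := ltn_ord (w (v, v)).
by case: ifP => _; [have := ltn_ord (w (u, u)) | have := ltn_ord (w (v, u))]; lia.
Qed.

Lemma deg_thr w v : deg (thr w) v = rank w v v + rest w v.
Proof.
rewrite /deg /rank /rest -cardsUI.
rewrite [X in _ + #|pred_of_set X|](_ : _ = set0) ?cards0 ?addn0; last first.
  apply/setP => u; rewrite !inE; case: (eqVneq u v) => [->|_] /=.
    by rewrite ltnn.
  by case: (u \in S v); rewrite ?andbF.
congr #|pred_of_set _|; apply/setP => u; rewrite !inE /thr.
case: (eqVneq u v) => [->|uv] /=; first by rewrite ltnn (negPf (Sirr v)).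
case: (boolP (u \in S v)) => [uS|uS] //=; rewrite -arcE //.
case: (boolP (v \in S u)) => [vS|vS] /=; last by rewrite !orbF.
by rewrite /arc uS vS addnC orbb orbF.
Qed.

(* Exchanges the values [val_at w v v] and [val_at w v a]: averaging over a shows that
   the rank of v among the d + 1 values at v is uniform up to ties. *)
Definition swap v a w : Om := [ffun i =>
  if i == (v, v) then rev_ord (val_at w v a)
  else if i == pos v a then val_at w v v else w i].

Lemma val_swap v a w b :
  val_at (swap v a w) v b = val_at w v (tperm v a b).
Proof.
have neq c : c != v -> (pos v c == (v, v)) = false.
  by move=> cv; apply: contraNF cv => /eqP E; rewrite -(pos2 v c) E.
rewrite {1}/val_at; case: (eqVneq b v) => [->|bv].
  by rewrite ffunE eqxx rev_ordK tpermL.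
rewrite ffunE neq //; case: (eqVneq b a) => [->|ba]; first by rewrite eqxx tpermR.
have -> : (pos v b == pos v a) = false.
  by apply: contraNF ba => /eqP E; rewrite -(pos2 v b) E pos2.
by rewrite tpermD; [rewrite /val_at (negPf bv) | rewrite eq_sym | rewrite eq_sym].
Qed.

Lemma rank_swap v a w : a \in star_at v -> rank (swap v a w) v v = rank w v a.
Proof.
move=> aA; rewrite /rank !val_swap tpermL.
rewrite -!sum1dep_card [RHS](reindex_inj (@perm_inj _ (tperm v a))) /=.
apply: eq_bigl => b; rewrite val_swap; congr (_ && _).
by case: tpermP => [->|->|] //; rewrite aA setU11.
Qed.

(** An arc in [rest] is owned by some [u] outside the star of [v] and reads only [w (u, u)] and
    [w (u, v)], which [swap] leaves alone. *)
Lemma rest_swap v a w : a \in star_at v -> rest (swap v a w) v = rest w v.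
Proof.
move=> aA; rewrite /rest; congr #|pred_of_set _|; apply/setP => u; rewrite !inE.
case: (boolP (u \in S v)) => //= uS; case: (boolP (v \in S u)) => //= vS.
have uv : u != v by rewrite eq_sym S_neq.
have same x : (x == u) || (x == v) -> swap v a w (u, x) = w (u, x).
  move=> xuv; rewrite ffunE xpair_eqE (negPf uv) /=; case: eqP => // E.
  have ax : x = a by rewrite -(pos2 v a) -E.
  case/orP: xuv => /eqP xE; move: E; rewrite -ax xE.
    by move: aA; rewrite -ax xE !inE (negPf uv) (negPf uS).
  by rewrite /pos eqxx => -[E]; rewrite E eqxx in uv.
by rewrite /arc (negPf uS) !same ?eqxx ?orbT.
Qed.

Lemma swapK v a : cancel (swap v a) (swap v a).
Proof.
move=> w; apply/ffunP => i; rewrite ffunE !val_swap tpermL tpermR.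
case: eqVneq => [->|iv].
  by rewrite /val_at eqxx rev_ordK.
case: eqVneq => [E|ia]; last by rewrite ffunE (negPf iv) (negPf ia).
rewrite E in iv *.
rewrite /val_at; case: (eqVneq a v) iv => // ->.
by rewrite {1}/pos eqxx eqxx.
Qed.

Definition tie w v := [exists a in star_at v, exists b in star_at v,
  (a != b) && (val_at w v a == val_at w v b)].

Lemma card_rank_fiber w v k : ~~ tie w v ->
  #|[set a in star_at v | rank w v a + rest w v == k]| <= 1.
Proof.
move=> nt; apply/card_le1P => a; rewrite !inE => /andP[aA /eqP ra] b.
rewrite !inE; apply/andP/eqP => [[bA /eqP rb]|->]; last by rewrite ra.
apply/eqP; apply: contraNT nt => ab.
apply/exists_inP; exists a; first by rewrite !inE.
apply/exists_inP; exists b; first by rewrite !inE.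
rewrite eq_sym ab /=; have rE : rank w v a = rank w v b.
  by apply/eqP; rewrite -(eqn_add2r (rest w v)) ra rb.
have mono x y : y \in star_at v -> val_at w v x < val_at w v y ->
    rank w v y < rank w v x.
  move=> yA xy; apply: proper_card; apply/properP; split.
    by apply/subsetP => z; rewrite !inE => /andP[-> /=]; apply: ltn_trans.
  by exists y; rewrite inE yA ?xy ?ltnn.
rewrite -val_eqE; case: ltngtP => // lt.
  by have := mono a b; rewrite rE ltnn !inE => /(_ bA lt).
by have := mono b a; rewrite rE ltnn !inE => /(_ aA lt).
Qed.

Lemma card_ties v : #|[set w : Om | tie w v]| * N <= d.+1 ^ 2 * #|{: Om}|.
Proof.
pose E a b := [set w : Om | (a != b) && (val_at w v a == val_at w v b)].
have EN a b : #|E a b| * N <= #|{: Om}|.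
  have [ab|ab] := eqVneq a b.
    by rewrite (_ : E a b = set0) ?cards0 //; apply/setP => w; rewrite !inE ab eqxx.
  have posI : pos v a != pos v b.
    by apply: contraNneq ab => pE; rewrite -(pos2 v a) pE pos2.
  have hb g : E a b \subset [set w : Om | w (pos v a) == g (w (pos v b))] ->
      #|E a b| * N <= #|{: Om}|.
    move=> sub; have := coincidence_bound g posI; rewrite card_ord.
    by apply: leq_trans; rewrite leq_mul2r subset_leq_card ?orbT.
  case: (eqVneq a v) posI hb => [av|av] posI hb.
    apply: (hb (@rev_ord N)); apply/subsetP => w; rewrite !inE => /andP[_].
    have bv : (b == v) = false by rewrite -av eq_sym (negPf ab).
    rewrite /val_at av eqxx bv => /eqP wE.
    by rewrite -wE rev_ordK {1}/pos eqxx.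
  case: (eqVneq b v) posI hb => [bv|bv] posI hb.
    apply: (hb (@rev_ord N)); apply/subsetP => w; rewrite !inE => /andP[_].
    by rewrite /val_at bv eqxx (negPf av) /pos eqxx.
  apply: (hb id); apply/subsetP => w; rewrite !inE => /andP[_].
  by rewrite /val_at (negPf av) (negPf bv).
apply: (@leq_trans (\sum_(s in setX (star_at v) (star_at v)) #|E s.1 s.2| * N)).
  rewrite -big_distrl leq_mul2r /=; apply/orP; right.
  apply: leq_trans (card_bigcup_le _ _); apply: subset_leq_card.
  apply/subsetP => w; rewrite inE => /exists_inP[a aA /exists_inP[b bA h]].
  by apply/bigcupP; exists (a, b); rewrite inE ?aA.
apply: (@leq_trans (\sum_(s in setX (star_at v) (star_at v)) #|{: Om}|)).
  by apply: leq_sum => s _; apply: EN.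
by rewrite sum_nat_const cardsX card_star_at mulnn.
Qed.

Lemma card_deg_thr v k :
  #|[set w : Om | deg (thr w) v == k]| * (d.+1 * N) <= #|{: Om}| * (N + d.+1 ^ 3).
Proof.
have E : d.+1 * #|[set w : Om | deg (thr w) v == k]| =
    \sum_w #|[set a in star_at v | rank w v a + rest w v == k]|.
  transitivity (\sum_(a in star_at v) \sum_w (rank w v a + rest w v == k)).
    rewrite -(card_star_at v) -sum_nat_const; apply: eq_bigr => a aA.
    rewrite -(card_imset _ (can_inj (swapK v a))) -sum1_card big_mkcond /=.
    apply: eq_bigr => w _; rewrite -{1}(swapK v a w) mem_imset; last exact: can_inj (swapK v a).
    by rewrite inE deg_thr rank_swap // rest_swap //; case: ifP.
  by rewrite exchange_big; apply: eq_bigr => w _; rewrite sum_set_card.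
have le : d.+1 * #|[set w : Om | deg (thr w) v == k]| <=
    #|{: Om}| + d.+1 * #|[set w : Om | tie w v]|.
  rewrite E -[#|{: Om}|]sum1_card -[#|[set w | tie w v]|]sum1dep_card big_distrr.
  rewrite [X in _ + X]big_mkcond -big_split; apply: leq_sum => w _ /=.
  case: ifP => [_|/negbT nt]; last by rewrite addn0 card_rank_fiber.
  rewrite muln1 (leq_trans _ (leq_addl _ _)) // -(card_star_at v).
  by apply: subset_leq_card; apply/subsetP => a; rewrite inE => /andP[].
rewrite mulnA [_ * d.+1]mulnC.
apply: leq_trans (leq_mul le (leqnn N)) _.
rewrite mulnDl mulnDr leq_add2l -mulnA.
apply: leq_trans (leq_mul (leqnn d.+1) (card_ties v)) _.
by rewrite mulnA -expnS mulnC.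
Qed.

Definition support v := [set i : V * V | v \in star_at i.1].

Lemma deg_thr_depends v k : depends_on (support v) (fun w => deg (thr w) v == k).
Proof.
move=> w w' ww'; congr (_ == k); congr #|pred_of_set _|; apply/setP => u.
rewrite !inE /thr /arc.
have vv x : w (v, x) = w' (v, x) by apply: ww'; rewrite !inE eqxx.
have uu x : v \in S u -> w (u, x) = w' (u, x).
  by move=> vu; apply: ww'; rewrite !inE vu orbT.
rewrite !vv; case: (boolP (v \in S u)) => vu; last by [].
by rewrite !uu.
Qed.

Lemma support_disjoint v v' :
  ~~ [exists u, (v \in star_at u) && (v' \in star_at u)] ->
  [disjoint support v & support v'].
Proof.
move=> h; rewrite disjoint_subset; apply/subsetP => -[u x].
rewrite !inE /= => vu; apply: contra h => vu'.
by apply/existsP; exists u; rewrite !inE vu vu'.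
Qed.

Lemma card_dependent :
  #|[set s : V * V | [exists u, (s.1 \in star_at u) && (s.2 \in star_at u)]]|
    <= #|V| * d.+1 ^ 2.
Proof.
apply: (@leq_trans #|\bigcup_u setX (star_at u) (star_at u)|).
  apply: subset_leq_card; apply/subsetP => -[a b]; rewrite inE => /existsP[u h].
  by apply/bigcupP; exists u => //; rewrite inE.
apply: leq_trans (card_bigcup_le _ _) _.
rewrite -sum_nat_const; apply: leq_sum => u _.
by rewrite cardsX card_star_at mulnn.
Qed.
End ThresholdSubgraph.

Lemma sum_deg_thr (V : finType) (S : V -> {set V}) (N d : nat)
    (w : {ffun V * V -> 'I_N}) :
  (forall v, #|S v| = d) -> \sum_v deg (thr S w) v <= 2 * (#|V| * d).
Proof.
move=> Sd; have SS : \sum_v \sum_u (u \in S v) = #|V| * d.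
  rewrite -sum_nat_const; apply: eq_bigr => v _; rewrite -(Sd v) -sum1_card.
  by rewrite [RHS]big_mkcond.
rewrite mul2n -addnn -{1}SS exchange_big -SS -big_split /=.
apply: leq_sum => v _; rewrite degE -big_split /=; apply: leq_sum => u _.
by rewrite /thr; do 2![case: (_ \in _)]; do 2?[case: (arc _ _ _ _)].
Qed.

(** At most [n * d.+1 ^ 2] pairs are dependent, so Chebyshev with deviation [t], summed over the
    [K1] small degrees, can only fail for [n <= 2 * K ^ 3 * d.+1 ^ 6]. *)
Lemma sparse_subgraph (V : finType) (e : rel V) (d K : nat) :
  simple_graph e -> (forall v, d <= deg e v) -> 0 < d -> 0 < K ->
  2 * K ^ 3 * d.+1 ^ 6 < #|V| ->
  exists h : rel V, spanning_subgraph h e /\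
    forall k, K * d.+1 * mult h k <= K.+1 * #|V| + K * d.+1.
Proof.
move=> sge degd d0 K0 nK; set n := #|V| in nK *.
have n0 : 0 < n by apply: leq_ltn_trans nK.
have Sex v : exists2 S : {set V}, S \subset [set u | e v u] & #|S| = d.
  exact: subset_of_card (degd v).
have [S SN Sd] := fin_all_exists2 Sex.
have Se v u : u \in S v -> e v u by move/(subsetP (SN v)); rewrite inE.
have Sirr v : v \notin S v by apply/negP => /Se; rewrite (proj2 sge).
(* Ties add at most [d.+1 ^ 2 / N = 1 / n] to each probability, hence at most 1 to an expected
   multiplicity. *)
pose N := n * d.+1 ^ 2.
have N0 : 0 < N by rewrite /N muln_gt0 n0 expn_gt0.
(* From [K1] on, the degree sum of at most [2 * n * d] already bounds each multiplicity by
   [n / (K * d.+1)]. *)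
pose K1 := 2 * K * d * d.+1.
suff [w wP] : exists w : {ffun V * V -> 'I_N},
    forall k, k < K1 -> K * d.+1 * mult (thr S w) k <= K.+1 * n + K * d.+1.
  exists (thr S w); split.
    split; first split.
    - exact: thr_sym.
    - by move=> v; rewrite /thr (negPf (Sirr v)).
    - move=> u v /orP[] /andP[/Se] //; by rewrite (proj1 sge).
  move=> k; case: (ltnP k K1) => [/wP //|kK].
  have : K1 * mult (thr S w) k <= 2 * (n * d).
    apply: leq_trans (sum_deg_thr w Sd); rewrite mulnC /mult -sum_nat_const.
    rewrite [X in X <= _]big_mkcond; apply: leq_sum => v _.
    by case: ifP => //; rewrite inE => /eqP->.
  have -> : K1 * mult (thr S w) k = 2 * d * (K * d.+1 * mult (thr S w) k).
    by rewrite /K1; ring.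
  have -> : 2 * (n * d) = 2 * d * n by ring.
  rewrite leq_pmul2l ?muln_gt0 // => /leq_trans; apply.
  by rewrite mulSn -addnA leq_addr.
pose Om := {ffun V * V -> 'I_N}.
pose f k v (w : Om) := deg (thr S w) v == k.
pose dep v v' := [exists u, (v \in star_at S u) && (v' \in star_at S u)].
have ind k v v' : ~~ dep v v' ->
    #|[set w | f k v w && f k v' w]| * #|Om| <= #|[set w | f k v w]| * #|[set w | f k v' w]|.
  move=> /support_disjoint dis; apply: independent_events dis _ _;
    exact: deg_thr_depends.
have Om0 : 0 < #|Om| by rewrite card_ffun card_ord expn_gt0 N0.
pose p k v : rat := (#|[set w | f k v w]|%:R / #|Om|%:R)%R.
pose t : rat := (n%:R / (K%:R * d.+1%:R))%R.
pose bad k := [set w : Om | (\sum_v p k v + t <= #|[set v | f k v w]|%:R)%R].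
have OR : (0 < #|Om|%:R :> rat)%R by rewrite ltr0n.
have dR : (0 < d.+1%:R :> rat)%R by rewrite ltr0n.
have KR : (0 < K%:R :> rat)%R by rewrite ltr0n.
have nR : (0 < n%:R :> rat)%R by rewrite ltr0n.
have t0 : (0 < t)%R by rewrite divr_gt0 // mulr_gt0.
have badk k : (#|bad k|%:R * t ^+ 2 <= #|Om|%:R * (n%:R * d.+1%:R ^+ 2))%R.
  apply: le_trans (second_moment (ind k) Om0 (ltW t0)) _.
  rewrite ler_wpM2l // -natrX -natrM ler_nat.
  exact: (card_dependent Sirr Sd).
have sump k : (\sum_v p k v <= n%:R / d.+1%:R + 1)%R.
  apply: (@le_trans _ _ (\sum_(v : V) (d.+1%:R^-1 + n%:R^-1))%R); last first.
    by rewrite sumr_const -[leLHS]mulr_natl -/n mulrDr mulfV ?gt_eqF.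
  apply: ler_sum => v _; rewrite /p ler_pdivrMr //.
  have := card_deg_thr N Sirr Sd v k; rewrite -(ler_nat rat).
  rewrite (natrM _ #|Om|) natrD natrX (natrM _ _ (d.+1 * N)) (natrM _ d.+1 N).
  have -> : (N%:R = n%:R * d.+1%:R ^+ 2 :> rat)%R by rewrite natrM natrX.
  move=> h.
  have c0 : (0 < d.+1%:R * (n%:R * d.+1%:R ^+ 2) :> rat)%R by rewrite !mulr_gt0 ?exprn_gt0.
  rewrite -(ler_pM2r c0) (le_trans h) // le_eqVlt; apply/orP; left; apply/eqP.
  by field; rewrite nat1r !gt_eqF.
have [w wgood|allbad] := pickP [pred w | w \notin \bigcup_(k : 'I_K1) bad k].
  exists w => k kK; move: wgood; rewrite /= => wgood.
  have : w \notin bad k.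
    by apply: contra wgood => wb; apply/bigcupP; exists (Ordinal kK).
  rewrite inE -ltNge => lt; have {}lt := lt_le_trans lt (lerD (sump k) (lexx t)).
  rewrite -(ler_nat rat) !natrD !natrM -/(mult _ _).
  have c0 : (0 < K%:R * d.+1%:R :> rat)%R by rewrite mulr_gt0.
  apply: le_trans (_ : (K%:R * d.+1%:R * (n%:R / d.+1%:R + 1 + t) <= _)%R).
    by rewrite ler_pM2l // ltW.
  rewrite /t -natr1 le_eqVlt; apply/orP; left; apply/eqP; field.
  by rewrite natr1 !gt_eqF.
have : (#|Om|%:R * t ^+ 2 <= K1%:R * (#|Om|%:R * (n%:R * d.+1%:R ^+ 2)))%R.
  apply: (@le_trans _ _ (\sum_(k < K1) #|bad k|%:R * t ^+ 2)%R).
    rewrite -mulr_suml -natr_sum ler_wpM2r ?sqr_ge0 // ler_nat.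
    apply: leq_trans (card_bigcup_le _ _); apply: subset_leq_card.
    by apply/subsetP => x _; have := allbad x; rewrite /= => /negbFE.
  apply: (@le_trans _ _ (\sum_(k < K1) (#|Om|%:R * (n%:R * d.+1%:R ^+ 2)))%R).
    by apply: ler_sum => k _; apply: badk.
  by rewrite sumr_const card_ord -[leLHS]mulr_natl.
rewrite [leRHS]mulrCA ler_pM2l // /t expr_div_n ler_pdivrMr ?exprn_gt0 ?mulr_gt0 //.
rewrite expr2 -mulrA [(K1%:R * _)%R]mulrCA -[(n%:R * _ * _)%R]mulrA ler_pM2l //.
rewrite -!(natrM, natrX) ler_nat => h.
have : n <= 2 * K ^ 3 * d.+1 ^ 6.
  apply: leq_trans h _; rewrite /K1.
  rewrite [X in X <= _](_ : _ = 2 * K ^ 3 * d.+1 ^ 5 * d); last by ring.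
  rewrite [d.+1 ^ 6]expnSr mulnA leq_mul2l; apply/orP; right; exact: leqnSn.
by rewrite leqNgt nK.
Qed.

(** * Asymptotics *)

(** It replaces logarithms: the requirement on [delta] becomes an inequality between powers of
    natural numbers. *)
Lemma expR_gt_exprn (R : realType) (x : R) (k : nat) :
  (0 < k)%N -> (0 <= x -> (x / k%:R) ^+ k < expR x)%R.
Proof.
move=> k0 x0; have kR : (0 < k%:R :> R)%R by rewrite ltr0n.
rewrite -[x in expR x](divfK (lt0r_neq0 kR)) expRM_natr.
apply: (@lt_le_trans _ _ ((1 + x / k%:R) ^+ k)%R).
  by rewrite ltrXn2r -?lt0n // ?ltrDr ?addr_ge0 ?divr_ge0 // ltW.
by rewrite lerXn2r ?nnegrE ?expR_ge0 ?addr_ge0 ?divr_ge0 ?expR_ge1Dx // ltW.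
Qed.

Lemma dense_subgraph (V : finType) (e : rel V) (c k d m q M : nat) :
  3200 <= c -> 0 < k -> 0 < #|V| -> simple_graph e -> (forall v, d <= deg e v) ->
  1 < m -> c * #|V| ^ 2 * (c * k * m ^ 4) ^ k <= d ^ k ->
  #|V| * m ^ 2 <= q * d * (m ^ 2 - 1) -> c * #|V| <= M * d * m ->
  exists h : rel V, spanning_subgraph h e /\ forall j, mult h j <= q + M.
Proof.
move=> c0 k0 V0 sge degd m1 hk hq hM; set n := #|V| in V0 hk hq hM.
have c1 : 0 < c by apply: leq_trans c0.
have m0 : 0 < m by apply: ltnW.
have ckm : c * k * m ^ 4 <= d.
  rewrite -(leq_exp2r _ _ k0); apply: leq_trans hk.
  by rewrite leq_pmull // muln_gt0 expn_gt0 V0 (leq_trans _ c0).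
have cm4 : 3200 * m ^ 4 <= d.
  apply: leq_trans ckm; rewrite leq_mul2r; apply/orP; right.
  by rewrite (leq_trans c0) // leq_pmulr.
have dn : d <= n.
  by case/card_gt0P: V0 => v _; apply: leq_trans (degd v) (max_card _).
(* [8 * L <= kap ^+ 2 * d] with [kap ^+ 2 = 1 / (400 * m ^ 4)] is where [c >= 3200] comes from. *)
pose L : Rdefinitions.R := (d%:R / (c%:R * m%:R ^+ 4))%R.
have cR : (3200 <= c%:R :> Rdefinitions.R)%R by rewrite (ler_nat _ 3200).
have m4 : (0 < m%:R ^+ 4 :> Rdefinitions.R)%R by rewrite exprn_gt0 // ltr0n ltnW.
have cm0 : (0 < c%:R * m%:R ^+ 4 :> Rdefinitions.R)%R by rewrite mulr_gt0 //; lra.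
apply: (@sample_subgraph _ V e d m q M L) => //.
- apply: leq_trans cm4; rewrite (@leq_trans (120 * m ^ 4)) //.
    by rewrite leq_mul2l leq_pexp2l ?orbT // ltnW.
  by rewrite leq_mul2r; apply/orP; right.
- have -> : ((m%:R^-1 ^+ 2 / 20) ^+ 2 * d%:R = d%:R / (400 * m%:R ^+ 4) :> Rdefinitions.R)%R.
    by field; rewrite pnatr_eq0 -lt0n ltnW.
  rewrite /L mulrCA ler_wpM2l // -ler_pdivlMl ?ltr0n // -invfM.
  have p8 : (0 < 8 * (400 * m%:R ^+ 4) :> Rdefinitions.R)%R by lra.
  rewrite lef_pV2 ?posrE //.
  have : (3200 * m%:R ^+ 4 <= c%:R * m%:R ^+ 4 :> Rdefinitions.R)%R by rewrite ler_pM2r.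
  by lra.
- have L0 : (0 <= L)%R by rewrite divr_ge0 // ltW.
  apply: lt_trans (expR_gt_exprn k0 L0).
  have -> : ((L / k%:R) ^+ k = d%:R ^+ k / (c%:R * k%:R * m%:R ^+ 4) ^+ k)%R.
    rewrite -expr_div_n /L; congr (_ ^+ k)%R; field.
    by rewrite !pnatr_eq0 -!lt0n k0 m0 c1.
  have ck0 : (0 < c%:R * k%:R * m%:R ^+ 4 :> Rdefinitions.R)%R.
    by rewrite !mulr_gt0 ?ltr0n.
  rewrite ltr_pdivlMr ?exprn_gt0 //.
  rewrite -!(natrX, natrM) ltr_nat; apply: leq_trans hk.
  rewrite ltn_pmul2r; last by rewrite expn_gt0 !muln_gt0 ?expn_gt0 ?k0 ?c1 ?m0.
  have mn : 3200 * m ^ 4 <= n by apply: leq_trans dn.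
  rewrite (_ : 20 * m ^ 2 * m * m = 20 * m ^ 4); last by ring.
  apply: (@leq_trans (3200 * n ^ 2)); last by rewrite leq_mul2r c0 orbT.
  move: (m ^ 4) mn V0 => a mn V0; clear -mn V0; nia.
- by apply: leq_trans hM; rewrite leq_mul2r (leq_trans _ c0) ?orbT.
Qed.

Lemma ceil_div_ge n d : n <= ceil_div n d * d.+1.
Proof. by rewrite /ceil_div; have := ltn_ceil (n + d) (ltn0Sn d); lia. Qed.

Lemma mrep_le (T : finType) (h : rel T) B : (forall k, mult h k <= B) -> mrep h <= B.
Proof. by move=> hB; apply/bigmax_leqP => k _; apply: hB. Qed.

Lemma spanning_self (T : finType) (e : rel T) : simple_graph e -> spanning_subgraph e e.
Proof. by []. Qed.

Lemma mrep_le_card (T : finType) (h : rel T) : mrep h <= #|T|.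
Proof. by apply: mrep_le => k; apply: max_card. Qed.

Lemma mindeg_lt_card n (e : rel 'I_n) d : simple_graph e -> is_mindeg e d -> d < n.
Proof.
move=> [_ irr] [_ [x <-]]; rewrite -[X in _ < X](card_ord n) -cardsT.
apply: proper_card; apply/properP; split; first exact: subsetT.
by exists x; rewrite ?inE ?irr.
Qed.

Lemma power_sparse n d p r : 0 < n -> 2 ^ r <= n -> r < 2 * p -> n ^ p <= d ^ r ->
  0 < r -> 2 * n <= d ^ 2.
Proof.
move=> n0 n2 rp npd r0; rewrite -(leq_exp2r _ _ r0) expnMn.
apply: (@leq_trans ((n ^ p) ^ 2)); last by rewrite -[leqRHS]expnM [2 * r]mulnC expnM leq_exp2r.
rewrite -expnM mulnC [p * 2]mulnC; apply: leq_trans (_ : n ^ r.+1 <= _).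
  by rewrite expnSr leq_mul2l n2 orbT.
by rewrite leq_pexp2l.
Qed.

(** The surplus 1 in [a.+1] covers two losses: [n / d - n / (d + 1)], less than [1 / 2], and that of
    the factor [1 - 1 / m ^ 2], about [n / (d * m ^ 2) <= 1 / m]. *)
Lemma floor_condition n d a m : 4 <= m -> 2 * n <= d ^ 2 -> n <= m * d ->
  n <= a * d.+1 -> n * m ^ 2 <= a.+1 * d * (m ^ 2 - 1).
Proof.
move=> m4 nd nmd na.
have key : 2 * (n * m ^ 2 + n * d + d ^ 2) <= 2 * (d ^ 2 * m ^ 2).
  have h1 : 2 * n * m ^ 2 <= d ^ 2 * m ^ 2 by rewrite leq_mul2r nd orbT.
  have h2 : n * d <= m * d * d by rewrite leq_mul2r nmd orbT.
  have h3 : 2 * (m + 1) * d ^ 2 <= m ^ 2 * d ^ 2.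
    by rewrite leq_mul2r; apply/orP; right; clear -m4; nia.
  by move: h1 h2 h3; clear; nia.
rewrite -(leq_pmul2r (ltn0Sn d)).
have m20 : 0 < m ^ 2 by rewrite expn_gt0 (leq_trans _ m4).
have h : (n + d.+1) * d * (m ^ 2 - 1) <= a.+1 * d * (m ^ 2 - 1) * d.+1.
  rewrite [leqRHS]mulnAC leq_mul2r; apply/orP; right.
  by rewrite [leqRHS]mulnAC leq_mul2r mulSn; apply/orP; right; clear -na; lia.
apply: leq_trans h; move: key m20; rewrite -[d ^ 2]mulnn.
move: (m ^ 2) => b; clear; case: b => // b + _; rewrite subn1 /= => key.
have := leq_mul (leqnn d) (leqnn b); lia.
Qed.

Section Asymptotics.
Variable c : nat.
Hypothesis c_ge : 3200 <= c.

Let c0 : 0 < c. Proof. exact: leq_trans c_ge. Qed.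

Definition dense_threshold k := c * (c * k * (c ^ 4 * 16)) ^ k.

(** With [m = c * a] the condition of [dense_subgraph] follows once [dense_threshold k * n ^ (4 * k
    + 2) <= d ^ (5 * k)]; one more factor [n] pays for the constant. *)
Lemma dense_concentration n d a k : 0 < d -> 0 < n -> a * d <= 2 * n ->
  dense_threshold k <= n -> n ^ (4 * k + 3) <= d ^ (5 * k) ->
  c * n ^ 2 * (c * k * (c * a) ^ 4) ^ k <= d ^ k.
Proof.
move=> d0 n0 ad cn nd.
have d4 : 0 < (d ^ 4) ^ k by rewrite !expn_gt0 d0.
rewrite -(leq_pmul2r d4) -mulnA -!expnMn.
have -> : d * d ^ 4 = d ^ 5 by rewrite expnS.
rewrite -(expnM d 5); apply: leq_trans nd.
have h : c * k * (c * a) ^ 4 * d ^ 4 <= c * k * (c ^ 4 * 16) * n ^ 4.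
  have -> : c * k * (c * a) ^ 4 * d ^ 4 = c * k * c ^ 4 * (a * d) ^ 4 by ring.
  have -> : c * k * (c ^ 4 * 16) * n ^ 4 = c * k * c ^ 4 * (2 * n) ^ 4 by ring.
  by rewrite leq_mul2l leq_exp2r // ad orbT.
have : (c * k * (c * a) ^ 4 * d ^ 4) ^ k <= (c * k * (c ^ 4 * 16) * n ^ 4) ^ k.
  by case: (posnP k) => [->|k0]; rewrite ?expn0 // leq_exp2r.
move/(leq_mul (leqnn (c * n ^ 2)))/leq_trans; apply.
rewrite (expnMn (c * k * (c ^ 4 * 16))) -(expnM n).
have -> : c * n ^ 2 * ((c * k * (c ^ 4 * 16)) ^ k * n ^ (4 * k)) =
    n ^ 2 * dense_threshold k * n ^ (4 * k).
  by rewrite /dense_threshold; move: (_ ^ k) (n ^ (4 * k)) => x y; ring.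
rewrite (_ : 4 * k + 3 = 2 + 1 + 4 * k); last by lia.
by rewrite !expnD expn1 leq_mul2r leq_mul2l cn !orbT.
Qed.

Lemma very_dense_case n (e : rel 'I_n) d :
  dense_threshold 93 + 2 ^ 31 <= n -> simple_graph e -> is_mindeg e d ->
  n ^ 25 <= d ^ 31 ->
  exists h : rel 'I_n, spanning_subgraph h e /\ mrep h <= ceil_div n d + 2.
Proof.
move=> nbig sge md nd.
have n31 : 2 ^ 31 <= n by apply: leq_trans nbig; apply: leq_addl.
have nth : dense_threshold 93 <= n by apply: leq_trans nbig; apply: leq_addr.
have n0 : 0 < n by apply: leq_trans n31; rewrite expn_gt0.
have dn := mindeg_lt_card sge md.
have d0 : 0 < d.
  by case: (d) nd => //; rewrite exp0n // leqn0 expn_eq0 -leqn0 leqNgt n0.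
pose a := n %/ d + 1.
have nad : n <= a * d by rewrite /a addn1 ltnW // ltn_ceil.
have adn : a * d <= 2 * n.
  by rewrite /a mulnDl mul1n; have := leq_trunc_div n d; lia.
have a0 : 0 < a by rewrite /a addn1.
(* A and B get one extra repetition each; [M = 1] is possible since [c * n <= d * (c * a)]. *)
have [|||||||||h [hs hm]] := @dense_subgraph 'I_n e c 93 d (c * a) (ceil_div n d).+1 1;
  rewrite ?card_ord //.
- by case: md.
- by rewrite (leq_trans _ (leq_mul c_ge a0)).
- apply: dense_concentration => //.
  (* 93 is the least [k] with [(4 * k + 3) / (5 * k) <= 25 / 31], and gives equality. *)
  have -> : 4 * 93 + 3 = 25 * 15 by [].
  have -> : 5 * 93 = 31 * 15 by [].
  by rewrite !expnM leq_exp2r.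
- apply: floor_condition; last exact: ceil_div_ge.
  + by apply: leq_trans (leq_mul c_ge a0).
  + exact: power_sparse nd _.
  + by apply: leq_trans nad _; rewrite leq_mul2r leq_pmull ?orbT.
- by rewrite mul1n [d * _]mulnC -mulnA leq_mul2l nad orbT.
exists h; split=> //; apply: mrep_le => k; apply: leq_trans (hm k) _.
by rewrite addn1 addn2.
Qed.

Lemma dense_case n (e : rel 'I_n) d K : 0 < K ->
  c * (c * 24 * (8 * c * K) ^ 4) ^ 24 + (4 * K) ^ 8 <= n ->
  simple_graph e -> is_mindeg e d -> n <= d ^ 8 ->
  exists h : rel 'I_n, spanning_subgraph h e /\
    K * mrep h <= K.+1 * ceil_div n d + 2 * K.
Proof.
move=> K0 nbig sge md nd.
have nth : c * (c * 24 * (8 * c * K) ^ 4) ^ 24 <= n by apply: leq_trans nbig; apply: leq_addr.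
have n8 : (4 * K) ^ 8 <= n by apply: leq_trans nbig; apply: leq_addl.
have dn := mindeg_lt_card sge md; have n0 : 0 < n by apply: leq_ltn_trans dn.
have dK : 4 * K <= d by rewrite -(@leq_exp2r _ _ 8) // (leq_trans n8).
have d0 : 0 < d by apply: leq_trans dK; rewrite muln_gt0.
(* This bounds the loss at A and the share of B by [n / (8 * K * d)] each. The rest of the allowance
   [1 / K] pays for replacing [d] by [d.+1], using [4 * K <= d]; rounding up [X] and [Y] gives the
   final 2. *)
pose m := 8 * c * K.
have m1 : 8 * K < m.
  by rewrite /m mulnAC ltn_Pmulr ?muln_gt0 // (leq_trans _ c_ge).
have m2 : 8 * K <= m ^ 2 - 1.
  by move: m1; clear -K0; case: (m) => // x; rewrite ltnS => h; nia.
have mm0 : 0 < m ^ 2 - 1 by apply: leq_trans m2; rewrite muln_gt0.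
pose X := n * m ^ 2 %/ (d * (m ^ 2 - 1)).
pose Y := c * n %/ (d * m).
have m0 : 0 < m by apply: leq_trans m1.
have [|||||||||h [hs hm]] := @dense_subgraph 'I_n e c 24 d m X.+1 Y.+1; rewrite ?card_ord //.
- by case: md.
- by apply: leq_trans m1; rewrite ltnS muln_gt0.
(* The number of events uses two factors [n] of [n ^ 3 <= d ^ 24]; the third pays for the
   constant. *)
- apply: (@leq_trans (n ^ 3)); last first.
    by rewrite -[24]/(8 * 3) expnM leq_exp2r.
  rewrite mulnAC (expnS n 2) leq_mul2r; apply/orP; right.
  exact: nth.
- by rewrite -mulnA ltnW // ltn_ceil // muln_gt0 d0.
- by rewrite -mulnA ltnW // ltn_ceil // muln_gt0 d0.
exists h; split=> //.
have := mrep_le hm; rewrite -(leq_pmul2l K0) => /leq_trans; apply.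
have XE : X * (d * (m ^ 2 - 1)) <= n * m ^ 2 by apply: leq_trunc_div.
have YE : Y * (d * m) <= c * n by apply: leq_trunc_div.
have X8 : 8 * K * (X * d) <= (8 * K).+1 * n.
  rewrite -(leq_pmul2r mm0).
  have -> : 8 * K * (X * d) * (m ^ 2 - 1) = 8 * K * (X * (d * (m ^ 2 - 1))) by ring.
  apply: leq_trans (leq_mul (leqnn (8 * K)) XE) _.
  have E : m ^ 2 = (m ^ 2 - 1).+1 by rewrite subn1 prednK // expn_gt0 m0.
  by rewrite {1}E; move: (m ^ 2 - 1) m2 => b; clear; nia.
have Y8 : 8 * K * (Y * d) <= n.
  by rewrite -(leq_pmul2l c0); apply: leq_trans YE; rewrite /m; lia.
have XY : 4 * K * ((X + Y) * d) <= (4 * K).+1 * n.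
  by move: X8 Y8; clear; lia.
have XY' : K * (X + Y) * d.+1 <= K.+1 * n.
  have p : 0 < 16 * K by rewrite muln_gt0.
  rewrite -(leq_pmul2l p).
  apply: (@leq_trans ((4 * K).+1 * (4 * K * ((X + Y) * d)))).
    move: (X + Y) => z; have := leq_mul (leqnn (4 * K * z)) dK; clear; lia.
  apply: leq_trans (leq_mul (leqnn _) XY) _.
  by move: K0; clear; nia.
have XYc : K * (X + Y) <= K.+1 * ceil_div n d.
  rewrite -(leq_pmul2r (ltn0Sn d)) (leq_trans XY') // -mulnA leq_mul2l.
  by rewrite ceil_div_ge orbT.
by move: XYc; clear; lia.
Qed.

Lemma sparse_case n (e : rel 'I_n) d K : 0 < K ->
  (128 * K ^ 3) ^ 4 <= n -> simple_graph e -> is_mindeg e d -> d ^ 8 < n ->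
  exists h : rel 'I_n, spanning_subgraph h e /\
    K * mrep h <= K.+1 * ceil_div n d + 2 * K.
Proof.
move=> K0 nbig sge md dn.
case: (posnP d) => [->|d0].
  exists e; split; first exact: spanning_self.
  rewrite /ceil_div addn0 divn1; have := mrep_le_card e; rewrite card_ord.
  by clear; nia.
(* By [d.+1 <= 2 * d] the left side is at most [128 * K ^ 3 * d ^ 6]; fourth powers are then
   compared using [d ^ 24 < n ^ 3]. *)
have nK : 2 * K ^ 3 * d.+1 ^ 6 < n.
  apply: (@leq_ltn_trans (128 * K ^ 3 * d ^ 6)).
    have h : d.+1 ^ 6 <= (2 * d) ^ 6 by rewrite leq_exp2r // mul2n -addnn -addn1 leq_add2l.
    apply: leq_trans (leq_mul (leqnn (2 * K ^ 3)) h) _.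
    by rewrite expnMn; apply: eq_leq; ring.
  rewrite -(@ltn_exp2r _ _ 4) // expnMn [n ^ 4]expnS.
  have h : (d ^ 6) ^ 4 < n ^ 3.
    by rewrite -expnM -[6 * 4]/(8 * 3) expnM ltn_exp2r.
  have n0 : 0 < n by apply: leq_ltn_trans dn.
  apply: (@leq_ltn_trans (n * (d ^ 6) ^ 4)); first by rewrite leq_mul2r nbig orbT.
  by rewrite ltn_pmul2l.
have [||h [hs hm]] := @sparse_subgraph 'I_n e d K sge _ d0 K0; rewrite ?card_ord //.
  by case: md.
exists h; split=> //.
have h2 k : mult h k <= (K.+1 * ceil_div n d + 2 * K) %/ K.
  rewrite leq_divRL // -(leq_pmul2r (ltn0Sn d)).
  have := hm k; rewrite card_ord; have := ceil_div_ge n d; clear; nia.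
by have := mrep_le h2; rewrite leq_divRL // mulnC.
Qed.
End Asymptotics.

(* From here on, as in the statement, [^] on [nat] is [Nat.pow] and [%R] is [R_scope]. *)
From Stdlib Require Import Reals Lra.

Lemma powE n k : Nat.pow n k = expn n k.
Proof. by elim: k => //= k ->; rewrite expnS. Qed.

(** Part (a) with [1 / K] in place of [eta n], cleared of division. *)
Definition nearly_optimal n K := forall (e : rel 'I_n) d,
  simple_graph e -> is_mindeg e d -> exists h : rel 'I_n, spanning_subgraph h e /\
    K * mrep h <= K.+1 * ceil_div n d + 2 * K.

Lemma eventually_nearly_optimal K : 0 < K -> exists n0, forall n, n0 <= n -> nearly_optimal n K.
Proof.
move=> K0; have [c hc] : exists c, 3200 <= c by exists 3200.
exists (c * (expn (c * 24 * (expn (8 * c * K) 4)) 24) + expn (4 * K) 8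
  + expn (128 * expn K 3) 4) => n hn e d sge md.
case: (leqP n (expn d 8)) => nd.
  by apply: (dense_case hc K0 _ sge md nd); apply: leq_trans hn; apply: leq_addr.
by apply: (sparse_case K0 _ sge md nd); apply: leq_trans hn; apply: leq_addl.
Qed.

(* The maximum makes sense since [nearly_optimal n 0] always holds. *)
Definition best_K n := \max_(K < n.+1 | `[< nearly_optimal n K >]) K.

Lemma best_K_optimal n : nearly_optimal n (best_K n).
Proof.
have [|K /asboolP nK] := @eq_bigmax_cond _ [pred K : 'I_n.+1 | `[< nearly_optimal n K >]]
    (fun K => val K).
  apply/card_gt0P; exists ord0; rewrite inE; apply/asboolP => e d sge _.
  by exists e; split; first exact: spanning_self.
by rewrite /best_K => ->.
Qed.

Theorem theorem1p4 :
  (exists eta : nat -> R,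
      (forall n, (0 <= eta n)%R) /\ Un_cv eta 0%R /\
      forall (n : nat) (e : rel 'I_n) (d : nat),
        simple_graph e -> is_mindeg e d ->
        exists h : rel 'I_n, spanning_subgraph h e /\
          (INR (mrep h) <= (1 + eta n) * INR (ceil_div n d) + 2)%R)
  /\
  (exists n0 : nat,
      forall (n : nat) (e : rel 'I_n) (d : nat),
        n0 <= n -> simple_graph e -> is_mindeg e d ->
        (* delta^{1.24} >= n, i.e. delta^{31/25} >= n, i.e. delta^31 >= n^25 *)
        n ^ 25 <= d ^ 31 ->
        exists h : rel 'I_n, spanning_subgraph h e /\
          mrep h <= ceil_div n d + 2).
Proof.
split; last first.
  (* [c] stays abstract, so that the powers in the threshold remain symbolic. *)
  have [c hc] : exists c, 3200 <= c by exists 3200.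
  exists (dense_threshold c 93 + expn 2 31) => n e d hn sge md.
  by rewrite !powE => nd; apply: (very_dense_case hc).
(* If no positive [K] up to [n] works, the value [n] is enough because [mrep h <= n]. *)
pose eta n := if best_K n == 0 then INR n else (/ INR (best_K n))%R.
have pos K : K != 0 -> (0 < INR K)%R.
  by move=> K0; apply: lt_0_INR; apply/ssrnat.ltP; rewrite lt0n.
exists eta; split; last split.
- move=> n; rewrite /eta; case: ifP => [_|/negbT /pos K0]; first exact: pos_INR.
  by apply: Rlt_le; apply: Rinv_0_lt_compat.
- move=> eps eps0; have [K [K0 Keps]] : exists K, 0 < K /\ (/ INR K < eps)%R.
    have [N [Ne N0]] := archimed_cor1 eps eps0.
    by exists N; split=> //; apply/ssrnat.ltP.
  have [n0 hn0] := eventually_nearly_optimal K0.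
  (* The summand [K] puts [K] into the range of the maximum [best_K n]. *)
  exists (n0 + K) => n /ssrnat.leP nN.
  have KK : K <= best_K n.
    have Kn : K < n.+1 by rewrite ltnS (leq_trans _ nN) // leq_addl.
    apply: (@leq_bigmax_cond _ _ (fun K => val K) (Ordinal Kn)).
    by apply/asboolP; apply: hn0; rewrite (leq_trans _ nN) // leq_addr.
  have bK0 : best_K n != 0 by rewrite -lt0n (leq_trans K0).
  rewrite /eta (negPf bK0) /R_dist Rminus_0_r Rabs_right; last first.
    by apply: Rle_ge; apply: Rlt_le; apply: Rinv_0_lt_compat; apply: pos.
  apply: Rle_lt_trans Keps; apply: Rinv_le_contravar.
    by apply: pos; rewrite -lt0n.
  by apply: le_INR; apply/ssrnat.leP.
move=> n e d sge md; have [h [hs hK]] := best_K_optimal sge md.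
exists h; split=> //; rewrite /eta; case: ifP => [/eqP K0|/negbT /pos K0].
  have n0 : 0 < n by apply: leq_ltn_trans (mindeg_lt_card sge md).
  have c1 : 1 <= ceil_div n d.
    by have := ceil_div_ge n d; case: (ceil_div n d) => //; rewrite mul0n leqNgt n0.
  have mn : (INR (mrep h) <= INR n)%R.
    by apply: le_INR; apply/ssrnat.leP; have := mrep_le_card h; rewrite card_ord.
  have c1R : (1 <= INR (ceil_div n d))%R by apply: (le_INR 1); apply/ssrnat.leP.
  by have := pos_INR n; Lra.nra.
have : (INR (best_K n) * INR (mrep h) <=
    (INR (best_K n) + 1) * INR (ceil_div n d) + 2 * INR (best_K n))%R.
  have := le_INR _ _ (elimT ssrnat.leP hK).
  by rewrite plus_INR !mult_INR S_INR.
move: K0; move: (INR (best_K n)) (INR (mrep h)) (INR (ceil_div n d)) => K m c K0 h1.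
have -> : m = (/ K * (K * m))%R by field; Lra.lra.
have -> : ((1 + / K) * c + 2 = / K * ((K + 1) * c + 2 * K))%R by field; Lra.lra.
by apply: Rmult_le_compat_l => //; apply: Rlt_le; apply: Rinv_0_lt_compat.
Qed.
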